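(* For every $f\in L^0(\mathbb{T})$ there exist complex coefficients $(c_k)_{k\ge1}$ such that $$f(t)=\sum_{k>0}c_k e^{ikt},$$ the series converging in measure; that is, the partial sums $\sum_{k=1}^N c_k e^{ikt}$ converge to $f$ in measure on $\mathbb{T}$ as $N\to\infty$.
   Context: $\mathbb{T}=\mathbb{R}/2\pi\mathbb{Z}$ with normalized Lebesgue measure, and $L^0(\mathbb{T})$ is the space of all measurable functions $f:\mathbb{T}\to\mathbb{C}$ (no integrability assumed). *)

(* Defs.v *)
From HB Require Import structures.
From mathcomp Require Import all_boot all_order all_algebra.
From mathcomp Require Import generic_quotient ring_quotient.
From mathcomp Require Import complex.
From mathcomp Require Import ring.
From mathcomp Require Import all_classical all_reals all_analysis.

Set Implicit Arguments.
Unset Strict Implicit.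
Unset Printing Implicit Defensive.
Import Order.TTheory GRing.Theory Num.Theory.
Import numFieldNormedType.Exports.

Local Open Scope classical_set_scope.
Local Open Scope ring_scope.
Local Open Scope complex_scope.
Local Open Scope quotient_scope.

Section torus.
Variable R : realType.

Definition twopiZ : {pred R} := [pred x | x / (2 * pi) \is a Num.int].

Fact twopiZ_zmod_closed : zmod_closed twopiZ.
Proof.
split=> [|x y]; rewrite !inE ?mul0r ?rpred0// => xZ yZ.
by rewrite mulrBl rpredB.
Qed.

HB.instance Definition _ := GRing.isZmodClosed.Build R twopiZ
  twopiZ_zmod_closed.

Definition torus : Type := Quotient.quot twopiZ.

HB.instance Definition _ := GRing.Zmodule.on torus.
HB.instance Definition _ := isPointed.Build torus 0.

Definition to_torus (x : R) : torus := \pi_(Quotient.quot twopiZ) x.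

Lemma eq_to_torus (x y : R) :
  to_torus x = to_torus y <-> exists k : int, x - y = k%:~R * (2 * pi).
Proof.
have pi2 : 2 * pi != 0 :> R by rewrite mulf_neq0 ?pnatr_eq0 ?gt_eqF// pi_gt0.
have -> : to_torus x = to_torus y <-> x - y \in twopiZ.
  by rewrite Quotient.idealrBE; split => [/eqP|/eqP].
rewrite inE; split => [/intrP[k xyk]|[k ->]]; last first.
  by rewrite mulfK// intr_int.
by exists k; rewrite -xyk mulfVK.
Qed.

Lemma to_torus_surj (t : torus) : exists x, to_torus x = t.
Proof. by exists (repr t); rewrite /to_torus reprK. Qed.

(* The measurable sets of [lebesgueR] are all the Lebesgue-measurable sets, not
   only the Borel ones. *)
Definition lebesgueR := caratheodory_type ((@wlength R idfun)^*)%mu.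

(* A set is measurable in the torus iff its preimage in R is. *)
Definition torus_measurable : set (set torus) :=
  image_set_system [set: lebesgueR] to_torus measurable.

Fact torus_sigma_algebra : sigma_algebra setT torus_measurable.
Proof. exact/sigma_algebra_image/sigma_algebra_measurable. Qed.

Fact torus_measurable0 : torus_measurable set0.
Proof. by case: torus_sigma_algebra. Qed.

Fact torus_measurableC A : torus_measurable A -> torus_measurable (~` A).
Proof. by move=> mA; rewrite -setTD; case: torus_sigma_algebra => _ + _; exact. Qed.

Fact torus_measurable_bigcup (F : (set torus)^nat) :
  (forall i, torus_measurable (F i)) -> torus_measurable (\bigcup_i F i).
Proof. by case: torus_sigma_algebra => _ _; exact. Qed.

Definition torus_display : measure_display. Proof. exact. Qed.

HB.instance Definition _ := isMeasurable.Build torus_display torus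
  torus_measurable0 torus_measurableC torus_measurable_bigcup.

Lemma measurable_torusE (A : set torus) :
  measurable A = measurable (to_torus @^-1` A : set lebesgueR).
Proof. by rewrite -[in RHS](setTI (_ @^-1` _)). Qed.

Definition torus_measure (A : set torus) : \bar R :=
  ((2 * pi)^-1)%:E *
  completed_lebesgue_measure (to_torus @^-1` A `&` [set` `[0%R, 2 * pi[%R]).

Fact measurable_fundamental_domain :
  measurable ([set` `[0%R, 2 * pi[%R] : set lebesgueR).
Proof. by apply: sub_caratheodory; exact: measurable_itv. Qed.

Lemma measurable_to_torus :
  measurable_fun [set: lebesgueR] (to_torus : lebesgueR -> torus).
Proof. by []. Qed.

Let twopiV_ge0 : 0 <= (2 * pi)^-1 :> R.
Proof. by rewrite invr_ge0 mulr_ge0// pi_ge0. Qed.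

Let nu : {measure set lebesgueR -> \bar R} :=
  mscale (NngNum twopiV_ge0)
    (mrestr completed_lebesgue_measure measurable_fundamental_domain).

Fact torus_measure0 : torus_measure set0 = 0%E.
Proof. by rewrite /torus_measure preimage_set0 set0I measure0 mule0. Qed.

Fact torus_measure_ge0 A : (0 <= torus_measure A)%E.
Proof. exact: (measure_ge0 nu). Qed.

Fact torus_measure_sigma_additive : semi_sigma_additive torus_measure.
Proof.
move=> F mF tF mUF; rewrite /torus_measure preimage_bigcup.
apply: (@measure_semi_sigma_additive _ _ _ nu (fun n => to_torus @^-1` F n)).
- by move=> n; rewrite -measurable_torusE.
- apply/trivIsetP => /= i j _ _ ij; rewrite -preimage_setI.
  by move/trivIsetP : tF => /(_ _ _ _ _ ij) ->//; rewrite preimage_set0.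
- by rewrite -preimage_bigcup -measurable_torusE.
Qed.

HB.instance Definition _ := isMeasure.Build _ _ _ torus_measure
  torus_measure0 torus_measure_ge0 torus_measure_sigma_additive.

Fact torus_measure_setT : torus_measure setT = 1%E.
Proof.
have pi2 : 0 < 2 * pi :> R by rewrite mulr_gt0// pi_gt0.
rewrite /torus_measure preimage_setT setTI.
have -> : completed_lebesgue_measure [set` `[0%R, 2 * pi[%R] = (2 * pi)%:E :> \bar R.
  have := @lebesgue_measure_itv R `[0%R, 2 * pi[%R.
  by rewrite /= lte_fin pi2 -EFinB subr0.
by rewrite -EFinM mulVf// gt_eqF.
Qed.

HB.instance Definition _ := Measure_isProbability.Build _ _ _ torus_measure
  torus_measure_setT.

(* [repr t] is an arbitrary real representative of t; the value does not depend
   on it, see [torus_expE]. *)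
Definition torus_exp (k : nat) (t : torus) : R[i] :=
  cos (k%:R * repr t) +i* sin (k%:R * repr t).

Let periodicz (g : R -> R) T : periodic g T ->
  forall (m : int) a, g (a + T *~ m) = g a.
Proof.
move=> gT [n|n] a; first by rewrite -pmulrn periodicn.
by rewrite NegzE mulrNz -(periodicn gT n.+1) -pmulrn subrK.
Qed.

Lemma torus_expE k x :
  torus_exp k (to_torus x) = cos (k%:R * x) +i* sin (k%:R * x).
Proof.
have /eq_to_torus[m /eqP] : to_torus (repr (to_torus x)) = to_torus x.
  by rewrite /to_torus reprK.
rewrite /torus_exp subr_eq => /eqP ->.
have -> : k%:R * (m%:~R * (2 * pi) + x) = k%:R * x + (pi *+ 2) *~ (k%:Z * m).
  by rewrite -[in RHS]mulrzl intrM -mulr_natl; ring.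
by rewrite (periodicz (@cosD2pi R)) (periodicz (@sinD2pi R)).
Qed.

(* Borel sigma-algebra on the codomain: the norm topology of the field R[i] is
   only inferred through the alias R[i]^o. *)
Definition L0 : set (torus -> R[i]) :=
  [set f | measurable_fun [set: torus]
             (f : torus -> g_sigma_algebraType (@open R[i]^o))].

End torus.

(* The norm of R[i] is R[i]-valued, hence the embedding of eps. *)
Definition cvg_in_measure d (T : measurableType d) (R : realType)
    (mu : {measure set T -> \bar R}) (f_ : (T -> R[i])^nat) (f : T -> R[i]) :=
  forall eps : R, 0 < eps ->
    mu [set x | eps%:C <= `|f_ n x - f x|] @[n --> \oo] --> 0%E.

(* Main.v *)
(* If r is the error left by the series built so far, it is approximated in
   measure by a trigonometric polynomial F = e^{-iKt} Q, and one adds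
   P = F (1 - H(e^{int})) with n large, where H is an analytic polynomial with
   H(0) = 1, tiny other coefficients, |H| <= 1/2 off a small set, and all of whose
   partial sums are at most 5 off a small set. The new error is about F H, at most
   |r| / 2 off a small set, and the partial sums of P are F times those of 1 - H up
   to one block with a tiny coefficient, hence at most 6 |r| plus a small error off
   a small set. Iterating, the error tends to 0 in measure together with all
   the intermediate partial sums.

   The point is that the bound 5 does not depend on how small the exceptional set
   is. Take H = Phi o w with w = sum_i s_i z^{n_i}, |s_i| = eps, n_i very lacunary
   and n_i = 1 mod m. The partial sums of H are the Phi o w_i, where w_i is a
   partial sum of w, up to an error controlled in L^2 by Parseval. The
   congruence makes w_i equivariant under rotation by the m-th root of unity, so w_i
   avoids a thin sector off a set of measure 1/m. Outside of this sector (within a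
   large disc) Phi is a polynomial approximating an average of J poles b / (b - x)
   with b on the positive axis at geometric scales: it is bounded by 4 everywhere and
   by 1/2 away from the origin. Finally the signs of the s_i are chosen greedily,
   keeping under control a Gaussian small-ball functional (so that |w| is
   large off a small set) and an exponential moment. *)
Require Import Defs.
From mathcomp Require Import all_boot all_order all_algebra complex.
From mathcomp Require Import all_classical all_reals all_analysis.
From mathcomp Require Import measurable_realfun zify ring lra.
Import Order.TTheory GRing.Theory Num.Theory.
Import numFieldNormedType.Exports.
Set Implicit Arguments.
Unset Strict Implicit.
Unset Printing Implicit Defensive.
Local Open Scope classical_set_scope.
Local Open Scope ring_scope.
Local Notation Re := complex.Re.
Local Notation Im := complex.Im.

(** * Translation invariance of Lebesgue measure, from intervals to outer measure *)

Section translation.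
Variable R : realType.
Notation lstar := ((@wlength R idfun)^*)%mu.

Let shiftr (c : R) : measurableTypeR R -> measurableTypeR R := fun x => x + c.

Let measurable_shiftr c : measurable_fun setT (shiftr c).
Proof. exact: measurable_funD. Qed.

Lemma lebesgue_measure_shift (c : R) (A : set (measurableTypeR R)) :
  measurable A ->
  lebesgue_measure ((fun x => x + c) @^-1` A) = lebesgue_measure A.
Proof.
move=> mA; apply/esym.
have -> : lebesgue_measure ((fun x => x + c) @^-1` A) =
  pushforward (@lebesgue_measure R) (shiftr c) A by [].
apply/lebesgue_measure_unique => //= _ [[a b] _ <-].
rewrite /pushforward.
have -> : shiftr c @^-1` [set` `]a, b]] = [set` `]a - c, b - c]].
  by apply/seteqP; split => x /=; rewrite /shiftr !in_itv/= ltrBlDr lerBrDr.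
rewrite !lebesgue_measure_itv/= !lte_fin ltrD2r.
by case: ifP => // _; rewrite -!EFinB; congr EFin; ring.
Qed.

Lemma outer_lebesgue_shift (c : R) (A : set R) :
  lstar ((fun x => x + c) @^-1` A) = lstar A.
Proof.
(* One inequality suffices, since the inverse of a translation is a translation. It holds because
   the outer measure is an infimum over open supersets, and these are translated along with the
   set. *)
suff h : forall (c : R) (A : set R), (lstar ((fun x : R => x + c)%R @^-1` A) <= lstar A)%E.
  apply/eqP; rewrite eq_le h/= -[leLHS](_ : lstar
    ((fun x => x - c) @^-1` ((fun x => x + c) @^-1` A)) = _) ?h//.
  by congr (lstar _); apply/seteqP; split => x /=; rewrite subrK.
move=> {}c {}A; rewrite [leRHS]outer_measure_open.
apply: le_ereal_inf_tmp => _ [U [oU AU] <-].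
rewrite -[leRHS](lebesgue_measure_shift c); last exact: open_measurable.
by apply: le_outer_measure => x; exact: AU.
Qed.

(** Cutting a test set X with the translated set amounts to cutting the set Y, which is X translated
    back, with A itself; the outer measure does not see the difference. *)
Lemma caratheodory_shift (c : R) (A : set R) :
  lstar.-caratheodory A -> lstar.-caratheodory ((fun x => x + c) @^-1` A).
Proof.
pose h (x : R) := x + c => mA X; pose Y : set R := (fun x => x - c) @^-1` X.
have -> : X = h @^-1` Y by apply/seteqP; split => x /=; rewrite /Y/= /h addrK.
have := outer_lebesgue_shift c Y; rewrite -/h => ->.
have := outer_lebesgue_shift c (Y `&` A); rewrite -/h preimage_setI => ->.
have := outer_lebesgue_shift c (Y `&` ~` A).
by rewrite -/h preimage_setI -preimage_setC => ->; exact: mA.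
Qed.

End translation.

(** * Rotation invariance of the measure on the torus *)

Section torus_shift.
Variable R : realType.
Notation mu := (@torus_measure R).
Notation T := (torus R).

Lemma to_torusD (x y : R) : to_torus (x + y) = to_torus x + to_torus y.
Proof. by rewrite /to_torus raddfD. Qed.

Definition shift (a x : T) : T := x + a.

Lemma preimage_shift (s : R) (A : set T) :
  @to_torus R @^-1` (shift (to_torus s) @^-1` A) =
  (fun x => x + s) @^-1` (@to_torus R @^-1` A).
Proof. by apply/seteqP; split => x /=; rewrite to_torusD. Qed.

Lemma measurable_shift (a : T) : measurable_fun setT (shift a).
Proof.
move=> _ A mA; rewrite setTI.
have [s <-] := to_torus_surj a.
rewrite measurable_torusE preimage_shift; apply: caratheodory_shift.
by rewrite measurable_torusE in mA.
Qed.

(** After reduction to a shift s in [0, 2 pi[, the fundamental domain becomes [s, 2 pi + s[. Its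
    overhang [2 pi, 2 pi + s[ is carried back to [0, s[ by periodicity. *)
Lemma torus_measure_shift (a : T) (A : set T) : measurable A ->
  mu (shift a @^-1` A) = mu A.
Proof.
have pi0 : 0 < 2 * pi :> R by rewrite mulr_gt0// pi_gt0.
suff h s : 0 <= s < 2 * pi -> measurable A ->
    mu (shift (to_torus s) @^-1` A) = mu A.
  have [x <-] := to_torus_surj a.
  pose k := Num.floor (x / (2 * pi)).
  have -> : to_torus x = to_torus (x - k%:~R * (2 * pi)).
    by apply/eq_to_torus; exists k; ring.
  apply: h; rewrite subr_ge0 ltrBlDr.
  have -> : 2 * pi + k%:~R * (2 * pi) = (k + 1)%:~R * (2 * pi) :> R.
    by rewrite intrD; ring.
  by rewrite -ler_pdivlMr// -ltr_pdivrMr// floor_le floorD1_gt.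
move=> {a} /andP[s0 s2] mA; rewrite /torus_measure preimage_shift; congr (_ * _)%E.
set B := @to_torus R @^-1` A.
have mB : measurable (B : set (lebesgueR R)) by rewrite -measurable_torusE.
have per x : B (x + 2 * pi) = B x.
  rewrite /B/=; congr A; apply/eq_to_torus; exists 1; ring.
have mI (i : interval R) : measurable ([set` i] : set (lebesgueR R)).
  by apply: sub_caratheodory; exact: measurable_itv.
transitivity (completed_lebesgue_measure (B `&` [set` `[s, 2 * pi + s[%R]) : \bar R).
  rewrite -[RHS](outer_lebesgue_shift s); congr (completed_lebesgue_measure _).
  by apply/seteqP; split => x /=; rewrite !in_itv/= lerDr ltrD2r.
have split1 : B `&` [set` `[s, 2 * pi + s[%R] =
    (B `&` [set` `[s, 2 * pi[%R]) `|` (B `&` [set` `[2 * pi, 2 * pi + s[%R]).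
  rewrite -setIUr; congr (_ `&` _); apply/seteqP; split => x /=; rewrite !in_itv/=.
    by move=> /andP[-> ->]; case: (ltP x (2 * pi)); [left|right].
  by move=> [/andP[? ?]|/andP[? ?]]; apply/andP; split; lra.
have split2 : B `&` [set` `[0, 2 * pi[%R] =
    (B `&` [set` `[s, 2 * pi[%R]) `|` (B `&` [set` `[0, s[%R]).
  rewrite -setIUr; congr (_ `&` _); apply/seteqP; split => x /=; rewrite !in_itv/=.
    by move=> /andP[-> ->]; case: (ltP x s); [right|left].
  by move=> [/andP[? ?]|/andP[? ?]]; apply/andP; split; lra.
rewrite split1 split2.
have dj (i j : interval R) : [set` i] `&` [set` j] = set0 ->
    (B `&` [set` i]) `&` (B `&` [set` j]) = set0.
  by move=> ij; rewrite setIACA ij setI0.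
rewrite [LHS]measureU; [|exact: measurableI|exact: measurableI|]; last first.
  apply: dj; apply/seteqP; split => x //=; rewrite !in_itv/= => -[/andP[? ?] /andP[? ?]]; lra.
rewrite [RHS]measureU; [|exact: measurableI|exact: measurableI|]; last first.
  apply: dj; apply/seteqP; split => x //=; rewrite !in_itv/= => -[/andP[? ?] /andP[? ?]]; lra.
congr (_ + _)%E.
rewrite -[LHS](outer_lebesgue_shift (2 * pi)); congr (completed_lebesgue_measure _).
apply/seteqP; split => x /=; rewrite !in_itv/= per => -[? /andP[? ?]].
  by split => //; apply/andP; split; lra.
by split => //; apply/andP; split; lra.
Qed.

Lemma integral_shift (a : T) (g : T -> \bar R) : measurable_fun setT g ->
  (forall t, 0 <= g t)%E ->
  (\int[mu]_t g (shift a t) = \int[mu]_t g t)%E.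
Proof.
move=> mg g0.
have ms := measurable_shift a.
pose nu : {measure set T -> \bar R} := pushforward mu (shift a).
have nuE A : measurable A -> A `<=` setT -> nu ms A = mu A.
  by move=> mA _; exact: torus_measure_shift.
have := @eq_measure_integral _ T R setT mu (nu ms) g nuE.
rewrite /nu (@ge0_integral_pushforward _ _ _ _ R _ ms mu setT g measurableT mg)//.
Qed.

End torus_shift.

(** * Complex-valued measurable functions *)

Section modulus.
Variable R : realType.
Implicit Types x y z : R[i].
Local Open Scope complex_scope.

(** The modulus as a real number, whereas the norm of [R[i]] is [R[i]]-valued. *)
Definition cabs (z : R[i]) : R := ComplexField.Normc.normc z.
Arguments cabs : simpl never.

Lemma norm_cabs z : `|z| = (cabs z)%:C. Proof. by []. Qed.

Lemma cabsE z : cabs z = Num.sqrt (Re z ^+ 2 + Im z ^+ 2).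
Proof. by case: z. Qed.

Lemma cabs_sqr z : cabs z ^+ 2 = Re z ^+ 2 + Im z ^+ 2.
Proof. by rewrite cabsE sqr_sqrtr// addr_ge0// sqr_ge0. Qed.

Lemma cabs_sqrC z : (cabs z ^+ 2)%:C = z * conjc z.
Proof. by rewrite rmorphXn/= -norm_cabs sqr_normc. Qed.

Lemma conjcM x y : conjc (x * y) = conjc x * conjc y.
Proof. exact: (rmorphM (@conjc R)). Qed.

Lemma conjcX x n : conjc (x ^+ n) = conjc x ^+ n.
Proof. exact: (rmorphXn (@conjc R)). Qed.

Lemma conjc_sum I (s : seq I) (P : pred I) (F : I -> R[i]) :
  conjc (\sum_(i <- s | P i) F i) = \sum_(i <- s | P i) conjc (F i).
Proof. exact: (rmorph_sum (@conjc R)). Qed.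

Lemma cabs_ge0 z : 0 <= cabs z. Proof. by rewrite cabsE sqrtr_ge0. Qed.

Lemma cabs0 : cabs 0 = 0. Proof. exact: ComplexField.Normc.normc0. Qed.
Lemma cabs1 : cabs 1 = 1. Proof. exact: ComplexField.Normc.normc1. Qed.

Lemma cabs_eq0 z : (cabs z == 0) = (z == 0).
Proof.
apply/eqP/eqP => [|->]; last exact: cabs0.
exact: ComplexField.Normc.eq0_normc.
Qed.

Lemma cabs_gt0 z : (0 < cabs z) = (z != 0).
Proof. by rewrite lt_def cabs_ge0 andbT cabs_eq0. Qed.

Lemma cabsM x y : cabs (x * y) = cabs x * cabs y.
Proof. exact: ComplexField.Normc.normcM. Qed.

Lemma cabsV x : cabs x^-1 = (cabs x)^-1.
Proof. exact: ComplexField.Normc.normcV. Qed.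

Lemma cabsX x n : cabs (x ^+ n) = cabs x ^+ n.
Proof. by elim: n => [|n IH]; rewrite ?expr0 ?cabs1// !exprS cabsM IH. Qed.

Lemma cabsN x : cabs (- x) = cabs x.
Proof. exact: (@normcN R). Qed.

Lemma cabsB x y : cabs (x - y) = cabs (y - x).
Proof. by rewrite -cabsN opprB. Qed.

Lemma ler_cabsD x y : cabs (x + y) <= cabs x + cabs y.
Proof. exact: (@le_normcD R). Qed.

Lemma ler_cabsB x y : cabs (x - y) <= cabs x + cabs y.
Proof. by rewrite -[cabs y]cabsN; exact: ler_cabsD. Qed.

Lemma ler_cabs_dist x y : cabs x - cabs y <= cabs (x - y).
Proof. by rewrite lerBlDr -{1}(subrK y x); exact: ler_cabsD. Qed.

Lemma ler_cabs_sum I (s : seq I) (P : pred I) (F : I -> R[i]) :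
  cabs (\sum_(i <- s | P i) F i) <= \sum_(i <- s | P i) cabs (F i).
Proof.
elim/big_ind2: _ => [|x a y b xa yb|//]; first by rewrite cabs0.
exact: le_trans (ler_cabsD _ _) (lerD xa yb).
Qed.

Lemma cabs_real (a : R) : cabs a%:C = `|a|.
Proof. by rewrite cabsE/= expr0n addr0 sqrtr_sqr. Qed.

Lemma ler_Re_cabs z : `|Re z| <= cabs z.
Proof. by rewrite -lecR -norm_cabs; exact: normc_ge_Re. Qed.

End modulus.
Arguments cabs : simpl never.

Section complex_measurable.
Context d (T : measurableType d) (R : realType).
Implicit Types f g : T -> R[i].

(** Stated through real and imaginary parts, so that closure under arithmetic reduces to real
    functions; [L0_cmeasurable] makes the link with [L0]. *)
Definition cmeasurable f :=
  measurable_fun [set: T] (fun t => Re (f t)) /\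
  measurable_fun [set: T] (fun t => Im (f t)).

Lemma cmeasurable_cst (c : R[i]) : cmeasurable (fun=> c).
Proof. by split; exact: measurable_cst. Qed.

Lemma cmeasurableD f g : cmeasurable f -> cmeasurable g ->
  cmeasurable (fun t => f t + g t).
Proof.
move=> [f1 f2] [g1 g2]; split.
  rewrite (_ : (fun _ => _) = (fun t => Re (f t) + Re (g t))).
    exact: measurable_funD.
  by apply/funext => t; case: (f t) => ? ?; case: (g t).
rewrite (_ : (fun _ => _) = (fun t => Im (f t) + Im (g t))).
  exact: measurable_funD.
by apply/funext => t; case: (f t) => ? ?; case: (g t).
Qed.

Lemma cmeasurableM f g : cmeasurable f -> cmeasurable g ->
  cmeasurable (fun t => f t * g t).
Proof.
move=> [f1 f2] [g1 g2]; split.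
  rewrite (_ : (fun _ => _) =
      (fun t => Re (f t) * Re (g t) - Im (f t) * Im (g t))).
    by apply: measurable_funB; exact: measurable_funM.
  by apply/funext => t; case: (f t) => ? ?; case: (g t).
rewrite (_ : (fun _ => _) =
    (fun t => Re (f t) * Im (g t) + Im (f t) * Re (g t))).
  by apply: measurable_funD; exact: measurable_funM.
by apply/funext => t; case: (f t) => ? ?; case: (g t).
Qed.

Lemma cmeasurableB f g : cmeasurable f -> cmeasurable g ->
  cmeasurable (fun t => f t - g t).
Proof.
move=> mf mg; rewrite (_ : (fun _ => _) = (fun t => f t + (-1) * g t)).
  by apply: cmeasurableD => //; apply: cmeasurableM => //; exact: cmeasurable_cst.
by apply/funext => t; rewrite mulN1r.
Qed.

Lemma cmeasurable_horner (p : {poly R[i]}) f : cmeasurable f ->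
  cmeasurable (fun t => p.[f t]).
Proof.
move=> mf; elim/poly_ind: p => [|p c IH].
  rewrite (_ : (fun _ => _) = fun=> 0); first exact: cmeasurable_cst.
  by apply/funext => t; rewrite horner0.
rewrite (_ : (fun _ => _) = (fun t => p.[f t] * f t + c)).
  by apply: cmeasurableD; [exact: cmeasurableM|exact: cmeasurable_cst].
by apply/funext => t; rewrite hornerMXaddC.
Qed.

Lemma measurable_cabs f : cmeasurable f ->
  measurable_fun [set: T] (fun t => cabs (f t)).
Proof.
move=> [f1 f2].
rewrite (_ : (fun _ => _) =
    Num.sqrt \o (fun t => Re (f t) ^+ 2 + Im (f t) ^+ 2)).
  apply: measurableT_comp.
    by apply: continuous_measurable_fun; exact: sqrt_continuous.
  by apply: measurable_funD; exact: measurable_funX.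
by apply/funext => t; rewrite /= cabsE.
Qed.

Lemma measurable_ger (g h : T -> R) : measurable_fun setT g ->
  measurable_fun setT h -> measurable [set t | g t <= h t].
Proof.
move=> mg mh; have := measurable_fun_ler mg mh.
by move=> /(_ measurableT [set true]); rewrite setTI; exact.
Qed.

Lemma measurable_gtr (g h : T -> R) : measurable_fun setT g ->
  measurable_fun setT h -> measurable [set t | g t < h t].
Proof.
move=> mg mh; have := measurable_fun_ltr mg mh.
by move=> /(_ measurableT [set true]); rewrite setTI; exact.
Qed.

End complex_measurable.

(** * Exponentials on the torus *)

Section torus_exp_theory.
Variable R : realType.
Notation mu := (@torus_measure R).
Notation T := (torus R).
Notation e := (@torus_exp R).
Local Open Scope complex_scope.

Lemma torus_exp0 t : e 0 t = 1.
Proof. by have [x <-] := to_torus_surj t; rewrite torus_expE mul0r cos0 sin0. Qed.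

Lemma torus_exp_add m n t : e (m + n) t = e m t * e n t.
Proof.
have [x <-] := to_torus_surj t; rewrite !torus_expE natrD mulrDl cosD sinD.
by congr (_ +i* _); rewrite addrC.
Qed.

Lemma torus_expX n m t : e (n * m) t = e n t ^+ m.
Proof.
elim: m => [|m IH]; first by rewrite muln0 torus_exp0.
by rewrite mulnS torus_exp_add IH exprS.
Qed.

Lemma torus_exp1X n t : e n t = e 1 t ^+ n.
Proof. by rewrite -torus_expX mul1n. Qed.

Lemma torus_exp_shift n a t : e n (shift a t) = e n a * e n t.
Proof.
have [x <-] := to_torus_surj t; have [y <-] := to_torus_surj a.
rewrite /shift -to_torusD !torus_expE mulrDr addrC cosD sinD.
by congr (_ +i* _); rewrite addrC.
Qed.

Lemma cabs_torus_exp n t : cabs (e n t) = 1.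
Proof. by rewrite cabsE/= cos2Dsin2 sqrtr1. Qed.

Lemma torus_exp_neq0 n t : e n t != 0.
Proof. by rewrite -cabs_gt0 cabs_torus_exp. Qed.

Lemma torus_expV n t : (e n t)^-1 = conjc (e n t).
Proof.
apply: (mulfI (torus_exp_neq0 n t)); rewrite divff ?torus_exp_neq0//.
by rewrite -cabs_sqrC cabs_torus_exp expr1n.
Qed.

Lemma measurable_torus_fun (g : R -> R) (h : T -> R) :
  measurable_fun setT g -> (forall x, h (to_torus x) = g x) ->
  measurable_fun setT h.
Proof.
move=> mg hg _ A mA; rewrite setTI measurable_torusE.
rewrite (_ : _ @^-1` _ = g @^-1` A).
  apply: sub_caratheodory; rewrite -[_ @^-1` _]setTI.
  exact: mg.
by apply/seteqP; split => x /=; rewrite hg.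
Qed.

Lemma cmeasurable_torus_exp n : cmeasurable (e n).
Proof.
have mn : measurable_fun setT (fun x : R => n%:R * x).
  exact: measurable_funM.
split.
  apply: (@measurable_torus_fun (cos \o (fun x : R => n%:R * x))).
    apply: measurableT_comp => //; apply: continuous_measurable_fun.
    exact: continuous_cos.
  by move=> x; rewrite torus_expE.
apply: (@measurable_torus_fun (sin \o (fun x : R => n%:R * x))).
  apply: measurableT_comp => //; apply: continuous_measurable_fun.
  exact: continuous_sin.
by move=> x; rewrite torus_expE.
Qed.

Definition unity_root m : R[i] := e 1 (to_torus (2 * pi / m%:R)).
Local Notation zeta := unity_root.

Lemma unity_rootX m k :
  zeta m ^+ k = cos (k%:R * (2 * pi / m%:R)) +i* sin (k%:R * (2 * pi / m%:R)).
Proof. by rewrite /zeta -torus_exp1X torus_expE. Qed.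

Lemma unity_root_expn m : (0 < m)%N -> zeta m ^+ m = 1.
Proof.
move=> m0; rewrite unity_rootX mulrC divfK ?pnatr_eq0 -?lt0n//.
by rewrite [2 * _]mulrC mulr_natr cos2pi sin2pi.
Qed.

Lemma cabs_unity_root m : cabs (zeta m) = 1.
Proof. exact: cabs_torus_exp. Qed.

(** The real part is cos 2y = 1 - 2 sin^2 y with y = pi j / m strictly between 0 and pi. *)
Lemma Re_unity_root_lt1 m j : (0 < j < m)%N -> Re (zeta m ^+ j) < 1.
Proof.
move=> /andP[j0 jm].
have m0 : 0 < m%:R :> R by rewrite ltr0n (leq_trans _ jm).
pose y : R := j%:R / m%:R * pi.
rewrite unity_rootX/= (_ : _ * (_ / _) = y *+ 2); last first.
  by rewrite /y; field; rewrite gt_eqF.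
have s0 : 0 < sin y.
  apply: sin_gt0_pi; rewrite mulr_gt0 ?pi_gt0//=; last first.
    by rewrite divr_gt0// ltr0n.
  by rewrite gtr_pMl ?pi_gt0// ltr_pdivrMr// mul1r ltr_nat.
rewrite cos_mulr2n cos2sin2; have := exprn_gt0 2 s0; lra.
Qed.

Lemma unity_root_neq1 m j : (0 < j < m)%N -> zeta m ^+ j != 1.
Proof. by move/Re_unity_root_lt1 => h; apply/eqP => h1; rewrite h1 ltxx in h. Qed.

(** Multiplying e^{int} by a root of unity is a translation of t, so that invariance of the measure
    applies to rotations of the value. *)
Lemma torus_exp_rotation n m j : (0 < n)%N -> (0 < m)%N ->
  exists a, forall t, zeta m ^+ j * e n t = e n (shift a t).
Proof.
move=> n0 m0; exists (to_torus (j%:R * (2 * pi / m%:R) / n%:R)) => t.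
rewrite torus_exp_shift unity_rootX torus_expE.
rewrite (_ : n%:R * (j%:R * (2 * pi / m%:R) / n%:R) = j%:R * (2 * pi / m%:R))//.
by field; rewrite !pnatr_eq0 -!lt0n n0 m0.
Qed.

Lemma measurable_rotation n m j (g : R[i] -> R) : (0 < n)%N -> (0 < m)%N ->
  measurable_fun setT (fun t => g (e n t)) ->
  measurable_fun setT (fun t => g (zeta m ^+ j * e n t)).
Proof.
move=> n0 m0 mg; have [a ea] := torus_exp_rotation j n0 m0.
under eq_fun do rewrite ea.
exact: (measurableT_comp mg (measurable_shift a)).
Qed.

Lemma integral_rotation (n m : nat) (g : R[i] -> R) :
  (0 < n)%N -> (0 < m)%N -> (forall z, 0 <= g z) ->
  measurable_fun setT (fun t => g (e n t)) ->
  (\int[mu]_t (\sum_(j < m) g (zeta m ^+ j * e n t))%:E =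
   m%:R%:E * \int[mu]_t (g (e n t))%:E)%E.
Proof.
move=> n0 m0 g0 mg.
under eq_integral => t _ do rewrite -sumEFin.
rewrite ge0_integral_sum//=; last 2 first.
- by move=> j; apply/measurable_EFinP; exact: measurable_rotation.
- by move=> j t _; rewrite lee_fin.
rewrite (eq_bigr (fun=> \int[mu]_t (g (e n t))%:E)%E); last first.
  move=> j _; have [a ea] := torus_exp_rotation j n0 m0.
  rewrite -(integral_shift a (g := fun t => (g (e n t))%:E))//.
  - by apply: eq_integral => t _; rewrite ea.
  - exact/measurable_EFinP.
  - by move=> t; rewrite lee_fin.
by rewrite big_const_ord mule_natl; exact/esym/Monoid.iteropE.
Qed.

End torus_exp_theory.

(** * Parseval's identity and averaging over roots of unity *)

Section parseval.
Variable R : realType.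
Notation mu := (@torus_measure R).
Notation T := (torus R).
Notation e := (@torus_exp R).
Notation zeta := (unity_root R).
Implicit Types p q : {poly R[i]}.
Local Open Scope complex_scope.

Lemma markov_torus (g : T -> R) (b : R) : 0 <= b -> (forall t, 0 <= g t) ->
  measurable_fun setT g ->
  (b%:E * mu [set t | (b <= g t)%R] <= \int[mu]_t (g t)%:E)%E.
Proof.
move=> b0 g0 mg; set A := [set t | _].
have mA : measurable A by apply: measurable_ger => //; exact: measurable_cst.
have <- : (\int[mu]_(t in A) (cst b%:E) t = b%:E * mu A)%E by rewrite integral_cst.
apply: (@le_trans _ _ (\int[mu]_(t in A) (g t)%:E)%E).
  apply: ge0_le_integral => //.
  by apply/measurable_EFinP; exact: measurable_funS mg.
apply: ge0_subset_integral => //; first exact/measurable_EFinP.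
by move=> t _; rewrite lee_fin.
Qed.

Lemma torus_integral_cst (c : R) : (\int[mu]_t (cst c%:E) t = c%:E)%E.
Proof.
rewrite integral_cst// [X in (_ * X)%E](_ : _ = 1%E) ?mule1//.
exact: torus_measure_setT.
Qed.

Lemma unity_root_orthogonal m (k l : 'I_m) :
  \sum_(j < m) zeta m ^+ (j * k) * conjc (zeta m ^+ (j * l)) = (k == l)%:R *+ m.
Proof.
have m0 : (0 < m)%N by case: m k l => [[]|].
set w := zeta m.
have w0 : w != 0 by rewrite -cabs_gt0 cabs_unity_root.
have wJ : conjc w = w^-1.
  apply: (mulfI w0); rewrite divff// -cabs_sqrC cabs_unity_root expr1n//.
pose r := w ^+ k * w^-1 ^+ l.
rewrite (eq_bigr (fun j : 'I_m => r ^+ j)); last first.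
  by move=> j _; rewrite conjcX wJ /r exprMn -!exprM [(k * j)%N]mulnC [(l * j)%N]mulnC.
have [kl|kl] := eqVneq k l.
  rewrite (eq_bigr (fun=> 1)); first by rewrite sumr_const card_ord.
  by move=> j _; rewrite /r kl exprVn divff ?expr1n// expf_neq0.
have neq1 (a b : 'I_m) : (b < a)%N -> w ^+ a * w^-1 ^+ b != 1.
  move=> ba; rewrite exprVn -expfB//; apply: unity_root_neq1.
  by rewrite subn_gt0 ba/= (leq_ltn_trans (leq_subr _ _)).
have r1 : r != 1.
  move: kl; rewrite -(inj_eq val_inj)/= neq_ltn => /orP[kl|]; last exact: neq1.
  by rewrite -invr_eq1 /r invfM -!exprVn invrK mulrC neq1.
have : r ^+ m - 1 = 0.
  by rewrite /r exprMn -!exprM mulnC exprM [(l * m)%N]mulnC exprM exprVn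
    unity_root_expn// invr1 !expr1n mul1r subrr.
rewrite subrX1 => /eqP; rewrite mulf_eq0 subr_eq0 (negbTE r1)/= => /eqP ->.
by rewrite mul0rn.
Qed.

(** The squared L^2 norm of t |-> p(e^{int}) for n > 0, by [parseval]. *)
Definition l2sq p : R := \sum_(k < size p) cabs p`_k ^+ 2.

Lemma l2sq_wide p m : (size p <= m)%N -> l2sq p = \sum_(k < m) cabs p`_k ^+ 2.
Proof.
move=> pm; rewrite /l2sq (big_ord_widen _ (fun k => cabs p`_k ^+ 2) pm).
rewrite [RHS](bigID (fun k : 'I_m => (k < size p)%N))/= [X in _ + X]big1 ?addr0//.
by move=> k; rewrite -leqNgt => h; rewrite nth_default// cabs0 expr0n.
Qed.

Lemma l2sq_coef p k : cabs p`_k ^+ 2 <= l2sq p.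
Proof.
have [kp|kp] := ltnP k (size p); last first.
  by rewrite nth_default// cabs0 expr0n sumr_ge0// => j _; rewrite sqr_ge0.
rewrite /l2sq (bigD1 (Ordinal kp))//= lerDl sumr_ge0// => j _.
by rewrite sqr_ge0.
Qed.

Lemma l2sq_take p M : l2sq (take_poly M p) <= l2sq p.
Proof.
have h : (size (take_poly M p) <= size p)%N.
  by apply/leq_sizeP => j pj; rewrite coef_take_poly nth_default// if_same.
rewrite (l2sq_wide h); apply: ler_sum => k _.
by rewrite coef_take_poly; case: ifP => // _; rewrite cabs0 expr0n sqr_ge0.
Qed.

(** Discrete Parseval: the m-th roots of unity separate all exponents below m, so every cross term
    cancels in the sum. *)
Lemma parseval_roots p m z : (size p <= m)%N -> cabs z = 1 ->
  \sum_(j < m) cabs p.[zeta m ^+ j * z] ^+ 2 = m%:R * l2sq p.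
Proof.
move=> pm z1; rewrite (l2sq_wide pm); apply: complexI.
rewrite rmorphM rmorph_nat !rmorph_sum/=.
under eq_bigr => j _.
  rewrite cabs_sqrC (horner_coef_wide _ pm) conjc_sum mulr_suml.
  under eq_bigr => k _ do rewrite mulr_sumr.
  over.
rewrite exchange_big/= mulr_sumr; apply: eq_bigr => k _.
rewrite exchange_big/= (bigD1 k)//= [X in _ + X]big1 ?addr0.
  rewrite (eq_bigr (fun=> (cabs p`_k ^+ 2)%:C)); last first.
    by move=> j _; rewrite -cabs_sqrC cabsM !cabsX cabsM cabsX cabs_unity_root
      z1 expr1n mulr1 expr1n mulr1.
  by rewrite sumr_const card_ord mulr_natl.
move=> l lk; rewrite (eq_bigr (fun j : 'I_m =>
  p`_k * conjc p`_l * (z ^+ k * conjc (z ^+ l)) *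
    (zeta m ^+ (j * k) * conjc (zeta m ^+ (j * l))))).
  by rewrite -mulr_sumr unity_root_orthogonal eq_sym (negbTE lk) mul0rn mulr0.
by move=> j _; rewrite !exprMn -!exprM !conjcM; ring.
Qed.

Lemma measurable_sqr_horner n p :
  measurable_fun setT (fun t => cabs p.[e n t] ^+ 2).
Proof.
apply: measurable_funX; apply: measurable_cabs; apply: cmeasurable_horner.
exact: cmeasurable_torus_exp.
Qed.

(** The sum of the integrand over m rotations is constant by [parseval_roots], and each rotation has
    the same integral; no exponential is integrated. *)
Lemma parseval n p : (0 < n)%N ->
  (\int[mu]_t (cabs p.[e n t] ^+ 2)%:E = (l2sq p)%:E)%E.
Proof.
move=> n0; pose m := (size p).+1.
have mE : m%:R != 0 :> R by rewrite pnatr_eq0.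
have := @integral_rotation R n m (fun z => cabs p.[z] ^+ 2) n0 isT
  (fun z => sqr_ge0 _) (measurable_sqr_horner n p).
rewrite (_ : \int[mu]_t _ = (m%:R * l2sq p)%:E)%E; last first.
  rewrite -torus_integral_cst; apply: eq_integral => t _.
  by rewrite parseval_roots ?cabs_torus_exp// leqnSn.
move=> h; rewrite -[LHS]mul1e -(mulVf mE) EFinM -muleA -h -EFinM mulKf//.
Qed.

Lemma rotation_bound n m (g : R[i] -> R) (b : R) :
  (0 < n)%N -> (0 < m)%N -> (forall z, 0 <= g z) ->
  measurable_fun setT (fun t => g (e n t)) ->
  (forall t, \sum_(j < m) g (zeta m ^+ j * e n t) <= b) ->
  (\int[mu]_t (g (e n t))%:E <= (b / m%:R)%:E)%E.
Proof.
move=> n0 m0 g0 mg gb.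
have mR : 0 < m%:R :> R by rewrite ltr0n.
have b0 : 0 <= b by apply: le_trans (gb 0); exact: sumr_ge0.
have h : (m%:R%:E * \int[mu]_t (g (e n t))%:E <= b%:E)%E.
  rewrite -(integral_rotation n0 m0 g0 mg).
  rewrite -torus_integral_cst.
  apply: ge0_le_integral => //.
  - by move=> t _; rewrite lee_fin sumr_ge0.
  - apply/measurable_EFinP; apply: measurable_sum => j.
    exact: measurable_rotation.
  - by move=> t _; rewrite lee_fin gb.
by rewrite mulrC EFinM lee_pdivlMl.
Qed.

End parseval.

(** * A polynomial small outside of a thin sector *)

Section peaking_polynomial.
Variable R : realType.
Implicit Types (p q : {poly R[i]}) (x : R[i]).
Local Open Scope complex_scope.

(** One pair (K, D) serves for the size of p and for its increments; the induction follows Horner's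
    scheme. *)
Lemma poly_growth p : exists K : R, exists D : nat, 0 <= K /\ forall x h,
  cabs h <= 1 -> cabs p.[x] <= K * (1 + cabs x) ^+ D /\
  cabs (p.[x + h] - p.[x]) <= cabs h * (K * (1 + cabs x) ^+ D).
Proof.
elim/poly_ind: p => [|p c [K [D [K0 IH]]]].
  exists 0, 0%N; split => // x h _.
  by rewrite !horner0 subrr cabs0 !mul0r mulr0.
exists (2 * K + cabs c), D.+1; split; first by rewrite addr_ge0 ?mulr_ge0 ?cabs_ge0.
move=> x h h1; have [IH1 IH2] := IH x h h1.
have x0 : 1 <= 1 + cabs x by rewrite lerDl cabs_ge0.
have c0 := cabs_ge0 c; have h0 := cabs_ge0 h; have xx0 := cabs_ge0 x.
set E := (1 + cabs x) ^+ D in IH1 IH2 *.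
have E1 : 1 <= E by exact: exprn_ege1.
have E0 : 0 <= E by exact: le_trans ler01 E1.
have KE0 : 0 <= K * E by rewrite mulr_ge0.
rewrite !hornerMXaddC exprS; split.
  apply: le_trans (ler_cabsD _ _) _; rewrite cabsM.
  have : cabs p.[x] * cabs x <= K * E * (1 + cabs x).
    by apply: ler_pM => //; rewrite ?cabs_ge0// lerDr.
  have : cabs c <= cabs c * ((1 + cabs x) * E).
    by rewrite ler_peMr// (le_trans x0)// ler_peMr// (le_trans ler01 x0).
  have : 0 <= K * E * (1 + cabs x) by rewrite mulr_ge0// addr_ge0.
  rewrite (_ : (2 * K + cabs c) * ((1 + cabs x) * E) =
    2 * (K * E * (1 + cabs x)) + cabs c * ((1 + cabs x) * E)); last by ring.
  lra.
rewrite (_ : _ - _ = (x + h) * (p.[x + h] - p.[x]) + h * p.[x]); last by ring.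
apply: le_trans (ler_cabsD _ _) _; rewrite !cabsM.
have h2 : cabs (x + h) * cabs (p.[x + h] - p.[x]) <=
    (1 + cabs x) * (cabs h * (K * E)).
  apply: ler_pM => //; rewrite ?cabs_ge0//.
  by apply: le_trans (ler_cabsD _ _) _; rewrite addrC lerD2r.
have h3 : cabs h * cabs p.[x] <= cabs h * (K * E) by rewrite ler_wpM2l.
have h4 : cabs h * (K * E) <= (1 + cabs x) * (cabs h * (K * E)).
  by rewrite ler_peMl// mulr_ge0.
have h5 : 0 <= cabs h * (cabs c * ((1 + cabs x) * E)).
  by rewrite !mulr_ge0// addr_ge0.
rewrite (_ : cabs h * ((2 * K + cabs c) * ((1 + cabs x) * E)) =
   2 * ((1 + cabs x) * (cabs h * (K * E))) + cabs h * (cabs c * ((1 + cabs x) * E))); last by ring.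
lra.
Qed.

Lemma geometric_remainder (w : R[i]) N : w != 1 ->
  (1 - w)^-1 - \sum_(n < N) w ^+ n = w ^+ N / (1 - w).
Proof.
move=> w1; have w2 : 1 - w != 0 by rewrite subr_eq0 eq_sym.
apply: (mulIf w2); rewrite mulrBl mulVf// mulfVK//.
have := subrX1 w N; set S := \sum_(_ < _) _ => wS.
rewrite (_ : S * (1 - w) = - ((w - 1) * S)); last by ring.
by rewrite -wS; ring.
Qed.

Section approximation.
Variables (c B : R).
Hypotheses (c0 : 0 < c) (c1 : c < 1) (B0 : 0 < B).

(** The disc of radius B with an open sector around the positive axis cut out; the poles to be
    approximated lie on that axis. *)
Definition pacman x := cabs x <= B /\ Re x <= c * cabs x.

(** With r = |x|, |b - x|^2 >= b^2 - 2bcr + r^2 = (r - bc)^2 + (1 - c^2) b^2, and 1 - c^2 >= (1 -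
    c)^2. *)
Lemma pacman_dist x (b : R) : Re x <= c * cabs x -> 0 < b ->
  (1 - c) * b <= cabs (b%:C - x).
Proof.
move=> xc b0; have cb : 0 <= (1 - c) * b by apply: mulr_ge0; rewrite ?subr_ge0; exact: ltW.
rewrite -(@ler_pXn2r _ 2) ?nnegrE ?cabs_ge0//.
have := cabs_sqr (b%:C - x); case: x xc => u v /= xc ->.
have := cabs_sqr (u +i* v); have := cabs_ge0 (u +i* v).
move: xc; set r := cabs _ => xc r0 /= rE.
have -> : (b - u) ^+ 2 + (0 - v) ^+ 2 = b ^+ 2 - 2 * b * u + r ^+ 2.
  by rewrite rE; ring.
have : b * u <= b * (c * r) by rewrite ler_pM2l.
have : 0 <= (r - b * c) ^+ 2 by exact: sqr_ge0.
have : 0 <= c * (1 - c) * b ^+ 2.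
  apply: mulr_ge0; last exact: sqr_ge0.
  by apply: mulr_ge0; rewrite ?subr_ge0; exact: ltW.
nra.
Qed.

Lemma pacman_neq x (b : R) : Re x <= c * cabs x -> 0 < b -> b%:C - x != 0.
Proof.
move=> xc b0; rewrite -cabs_gt0; apply: lt_le_trans (pacman_dist xc b0).
by rewrite mulr_gt0// subr_gt0.
Qed.

Lemma pacman_inv x (b : R) : Re x <= c * cabs x -> 0 < b ->
  cabs (b%:C - x)^-1 <= ((1 - c) * b)^-1.
Proof.
move=> xc b0; rewrite cabsV lef_pV2 ?pacman_dist// posrE.
  by rewrite cabs_gt0 pacman_neq.
by rewrite mulr_gt0// subr_gt0.
Qed.

Definition papprox (f : R[i] -> R[i]) := forall eta : R, 0 < eta ->
  exists p, forall x, pacman x -> cabs (f x - p.[x]) <= eta.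

Lemma papproxD f g : papprox f -> papprox g -> papprox (fun x => f x + g x).
Proof.
move=> fP gP eta eta0; have e2 : 0 < eta / 2 by rewrite divr_gt0.
have [p pP] := fP _ e2; have [q qP] := gP _ e2.
exists (p + q) => x Gx; rewrite hornerD opprD addrACA.
by apply: le_trans (ler_cabsD _ _) _; rewrite [eta]splitr lerD ?pP ?qP.
Qed.

Lemma papprox_cst a : papprox (fun=> a).
Proof. by move=> eta eta0; exists a%:P => x _; rewrite hornerC subrr cabs0 ltW. Qed.

Lemma papproxZ f a : papprox f -> papprox (fun x => a * f x).
Proof.
move=> fP eta eta0.
have a0 : 0 < cabs a + 1 by rewrite ltr_wpDl ?cabs_ge0.
have [p pP] := fP (eta / (cabs a + 1)) (divr_gt0 eta0 a0).
exists (a *: p) => x Gx; rewrite hornerZ -mulrBr cabsM.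
apply: (@le_trans _ _ (cabs a * (eta / (cabs a + 1)))).
  by rewrite ler_wpM2l ?cabs_ge0 ?pP.
rewrite mulrA ler_pdivrMr// mulrC ler_pM2l// lerDl//.
Qed.

Lemma papprox_sum (I : Type) (s : seq I) (f : I -> R[i] -> R[i]) :
  (forall i, papprox (f i)) -> papprox (fun x => \sum_(i <- s) f i x).
Proof.
move=> fP; elim: s => [|i s IH].
  under eq_fun do rewrite big_nil; exact: papprox_cst.
by under eq_fun do rewrite big_cons; exact: papproxD.
Qed.

Lemma papprox_comp f (S : {poly R[i]}) (M : R) :
  (forall x, pacman x -> cabs (f x) <= M) -> papprox f ->
  papprox (fun x => S.[f x]).
Proof.
move=> fM fP eta eta0; have [K [D [K0 SP]]] := poly_growth S.
pose L := K * (1 + `|M|) ^+ D + 1.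
have L0 : 0 < L by rewrite ltr_wpDl// mulr_ge0// exprn_ge0// addr_ge0.
have e0 : 0 < Num.min 1 (eta / L) by rewrite lt_min ltr01 divr_gt0.
have [p pP] := fP _ e0; exists (S \Po p) => x Gx.
have := pP x Gx; rewrite le_min => /andP[h1 h2].
rewrite horner_comp cabsB; have -> : p.[x] = f x + (p.[x] - f x) by ring.
rewrite cabsB in h1 h2.
have [_ h3] := SP (f x) _ h1; apply: le_trans h3 _.
apply: (@le_trans _ _ (eta / L * L)); last by rewrite divfK ?gt_eqF.
apply: ler_pM => //; first exact: cabs_ge0.
  by rewrite mulr_ge0// exprn_ge0// addr_ge0// cabs_ge0.
rewrite /L ler_wpDr// ler_wpM2l// lerXn2r ?nnegrE ?addr_ge0 ?cabs_ge0//.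
by rewrite lerD2l (le_trans (fM x Gx))// ler_norm.
Qed.

Lemma papprox_lim f (g : nat -> R[i] -> R[i]) (u : R) :
  (forall N, papprox (g N)) ->
  (forall N x, pacman x -> cabs (f x - g N x) <= u * 2^-1 ^+ N) -> papprox f.
Proof.
move=> gP fg eta eta0.
pose N := Num.bound (u * 2 / eta).
have uN : u * 2^-1 ^+ N <= eta / 2.
  rewrite exprVn ler_pdivrMr ?exprn_gt0//.
  have : u * 2 / eta <= 2 ^+ N.
    exact/ltW/upper_nthrootP.
  by rewrite ler_pdivrMr// => h; lra.
have [p pP] := gP N (eta / 2) (divr_gt0 eta0 (ltr0n _ 2)).
exists p => x Gx; have -> : f x - p.[x] = (f x - g N x) + (g N x - p.[x]) by ring.
apply: le_trans (ler_cabsD _ _) _; rewrite [eta]splitr lerD ?pP//.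
exact: le_trans (fg N x Gx) uN.
Qed.

(** For |x| <= B < b / 2 the geometric series in x / b converges with ratio at most 1/2. *)
Lemma papprox_far (b : R) : 2 * B < b -> papprox (fun x => (b%:C - x)^-1).
Proof.
have B0' := B0; move=> Bb; have b0 : 0 < b by lra.
pose g N x : R[i] := (\sum_(n < N) ((b^-1)%:C ^+ n.+1)%:P * 'X^n).[x].
apply: (@papprox_lim _ g ((1 - c) * b)^-1).
  move=> N eta eta0; exists (\sum_(n < N) ((b^-1)%:C ^+ n.+1)%:P * 'X^n) => x _.
  by rewrite subrr cabs0 ltW.
move=> N x [xB xc]; have bx := pacman_neq xc b0.
have bC : b%:C != 0 by rewrite -cabs_gt0 cabs_real normr_gt0 gt_eqF.
pose w := x / b%:C.
have wE : b%:C - x = b%:C * (1 - w) by rewrite /w mulrBr mulr1 mulrC divfK.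
have w1 : w != 1.
  by apply: contraNneq bx => w1; rewrite wE w1 subrr mulr0.
have -> : g N x = (b%:C)^-1 * \sum_(n < N) w ^+ n.
  rewrite /g horner_sum mulr_sumr; apply: eq_bigr => n _.
  rewrite hornerM hornerC hornerXn /w expr_div_n exprS fmorphV -exprVn; ring.
rewrite wE invfM -mulrBr geometric_remainder// mulrCA -invfM -wE cabsM mulrC.
apply: ler_pM; rewrite ?cabs_ge0 ?pacman_inv//.
rewrite cabsX lerXn2r ?nnegrE ?cabs_ge0 ?invr_ge0// /w cabsM cabsV cabs_real gtr0_norm//.
by rewrite ler_pdivrMr//; lra.
Qed.

(* Runge's pole pushing: the pole at b is moved to the nearby point a. *)
Lemma papprox_step (a b : R) : 0 < a -> 0 < b -> `|b - a| <= (1 - c) * b / 2 ->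
  papprox (fun x => (b%:C - x)^-1) -> papprox (fun x => (a%:C - x)^-1).
Proof.
move=> a0 b0 ab bP; pose d : R[i] := (b - a)%:C.
pose S N : {poly R[i]} := \sum_(n < N) (d ^+ n)%:P * 'X^(n.+1).
apply: (@papprox_lim _ (fun N x => (S N).[(b%:C - x)^-1]) ((1 - c) * a)^-1).
  move=> N; have fM x : pacman x -> cabs (b%:C - x)^-1 <= ((1 - c) * b)^-1.
    by move=> [_ xc]; exact: pacman_inv.
  exact: (papprox_comp (S N) fM bP).
move=> N x [xB xc]; have bx := pacman_neq xc b0; have ax := pacman_neq xc a0.
(* Here 1 / (a - x) = u / (1 - d u) is expanded as a power series in u, with |d u| <= 1/2 on the
   region; its partial sums are polynomials in u. *)
set u := (b%:C - x)^-1; pose w := d * u.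
have wE : a%:C - x = (b%:C - x) * (1 - w).
  by rewrite /w /u /d rmorphB/=; field.
have w1 : w != 1 by apply: contraNneq ax => w1; rewrite wE w1 subrr mulr0.
have -> : (S N).[u] = u * \sum_(n < N) w ^+ n.
  rewrite /S horner_sum mulr_sumr; apply: eq_bigr => n _.
  by rewrite hornerM hornerC hornerXn /w exprMn exprS; ring.
rewrite wE invfM -mulrBr geometric_remainder// mulrCA -invfM -wE cabsM mulrC.
apply: ler_pM; rewrite ?cabs_ge0 ?pacman_inv//.
rewrite cabsX lerXn2r ?nnegrE ?cabs_ge0 ?invr_ge0// /w cabsM /d cabs_real.
have c1' : 0 < 1 - c by rewrite subr_gt0.
apply: (@le_trans _ _ ((1 - c) * b / 2 * ((1 - c) * b)^-1)).
  by apply: ler_pM; rewrite ?cabs_ge0 ?pacman_inv.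
by rewrite mulrAC divff ?mul1r// mulf_neq0 ?gt_eqF.
Qed.

Lemma papprox_inv (a : R) : 0 < a -> papprox (fun x => (a%:C - x)^-1).
Proof.
(* A pole placed beyond 2B at a / th^k is brought to a in k moves of ratio [th]; 1 - th = (1 - c) /
   2 is exactly the displacement that [papprox_step] allows. *)
have c0' := c0; have c1' := c1; move=> a0; pose th := 1 - (1 - c) / 2.
have th0 : 0 < th by rewrite /th; lra.
have th1 : th < 1 by rewrite /th; lra.
have [k ak] : exists k, 2 * B < a / th ^+ k.
  pose y := th^-1 - 1.
  have y0 : 0 < y by rewrite subr_gt0 invf_gt1.
  exists (Num.bound (2 * B / a / y)).
  set k := Num.bound _; have : 2 * B / a / y < k%:R.
    by apply: archi_boundP; rewrite divr_ge0 ?divr_ge0// ?mulr_ge0 ?ltW.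
  rewrite ltr_pdivrMr// ltr_pdivrMr// => h; apply: lt_le_trans h _.
  rewrite mulrC ler_pM2l// -exprVn (_ : th^-1 = 1 + y); last by rewrite /y; ring.
  elim: k => [|k IH]; first by rewrite mul0r expr0.
  rewrite exprS -natr1 mulrDl mul1r.
  have : 1 <= (1 + y) ^+ k by apply: exprn_ege1; lra.
  nra.
have [b bE] : exists b, b = a / th ^+ k by exists (a / th ^+ k).
have b0 : 0 < b by rewrite bE divr_gt0// exprn_gt0.
have -> : a = th ^+ k * b by rewrite bE mulrC divfK// expf_neq0// gt_eqF.
rewrite -bE in ak; elim: k {bE} => [|k IH]; first by rewrite expr0 mul1r; exact: papprox_far.
have p0 : 0 < th ^+ k * b by rewrite mulr_gt0// exprn_gt0.
apply: papprox_step IH => //; first by rewrite mulr_gt0// exprn_gt0.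
rewrite exprS -mulrA -{1}[th ^+ k * b]mul1r -mulrBl normrM gtr0_norm ?subr_gt0//.
by rewrite gtr0_norm// /th; lra.
Qed.

End approximation.

Section averaged_poles.
Variables (c : R) (J : nat).
Hypotheses (c0 : 0 < c) (c1 : c < 1) (J0 : (0 < J)%N) (Jc : (1 - c)^-1 <= J%:R).

Let b (i : nat) : R := 4 ^+ i.
Let b0 i : 0 < b i. Proof. exact: exprn_gt0. Qed.

Definition averaged_poles x : R[i] :=
  (J%:R^-1)%:C * \sum_(i < J) (b i)%:C * ((b i)%:C - x)^-1.

Lemma averaged_poles0 : averaged_poles 0 = 1.
Proof.
rewrite /averaged_poles (eq_bigr (fun=> 1)); last first.
  move=> i _; rewrite subr0 divff// -cabs_gt0 cabs_real normr_gt0 gt_eqF//.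
rewrite sumr_const card_ord fmorphV/= rmorph_nat mulVf//.
by rewrite pnatr_eq0 -lt0n.
Qed.

Lemma averaged_poles_le x (M : R) :
  \sum_(i < J) cabs ((b i)%:C * ((b i)%:C - x)^-1) <= M * J%:R ->
  cabs (averaged_poles x) <= M.
Proof.
have J1 : 0 < J%:R :> R by rewrite ltr0n.
move=> h; rewrite cabsM cabs_real gtr0_norm ?invr_gt0// mulrC ler_pdivrMr//.
exact: le_trans (ler_cabs_sum _ _ _) h.
Qed.

Lemma pole_le x i (r M : R) : 0 < r -> b i <= M * r -> 0 <= M ->
  r <= cabs ((b i)%:C - x) -> cabs ((b i)%:C * ((b i)%:C - x)^-1) <= M.
Proof.
move=> r0 bM M0 rx; have x0 := lt_le_trans r0 rx.
rewrite cabsM cabs_real gtr0_norm// cabsV ler_pdivrMr//.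
by apply: le_trans bM _; rewrite ler_wpM2l.
Qed.

(* The pole scales grow geometrically, so at most one pole lies at a distance
   from x comparable to |x|; all the other terms are at most 2. *)
Lemma averaged_poles_bound x : Re x <= c * cabs x ->
  cabs (averaged_poles x) <= 3.
Proof.
move=> xc; apply: averaged_poles_le.
have c1' : 0 < 1 - c by rewrite subr_gt0.
have x0 := cabs_ge0 x.
pose bad i := (cabs x < 2 * b i) && (b i < 2 * cabs x).
have term i : cabs ((b i)%:C * ((b i)%:C - x)^-1) <= 2 + (bad i)%:R * (1 - c)^-1.
  have cV : 0 < (1 - c)^-1 by rewrite invr_gt0.
  case: (boolP (bad i)) => [_|].
    rewrite mul1r; apply: (@le_trans _ _ (1 - c)^-1); last by lra.
    apply: (@pole_le _ _ ((1 - c) * b i)); rewrite ?mulr_gt0 ?pacman_dist//.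
      by rewrite mulrA mulVf ?gt_eqF// mul1r.
    exact: ltW.
  rewrite negb_and -!leNgt mul0r addr0 => /orP[h|h].
    apply: (@pole_le _ _ (b i)) => //.
      by have := b0 i; lra.
    rewrite cabsB; apply: le_trans (ler_cabs_dist _ _).
    by rewrite cabs_real gtr0_norm//; lra.
  apply: (@pole_le _ _ (b i / 2)) => //; first by rewrite divr_gt0.
    by rewrite mulrC divfK.
  apply: le_trans (ler_cabs_dist _ _).
  by rewrite cabs_real gtr0_norm//; lra.
apply: (@le_trans _ _ (\sum_(i < J) (2 + (bad i)%:R * (1 - c)^-1))).
  by apply: ler_sum => i _; exact: term.
rewrite big_split/= sumr_const card_ord -mulr_suml.
have badU i j : bad i -> bad j -> (i <= j)%N.
  move=> /andP[_ h1] /andP[h2 _].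
  have : b i < b j.+1 by rewrite [b j.+1](_ : _ = 4 * b j); [lra|exact: exprS].
  by rewrite /b ltr_eXn2l ?ltr1n// ltnS.
have sum1 : \sum_(i < J) (bad i)%:R <= 1 :> R.
  case: (pickP (fun i : 'I_J => bad i)) => [i0 bi0|none].
    rewrite (bigD1 i0)//= [X in _ + X]big1 ?addr0 ?lern1 ?leq_b1// => i ii0.
    case: (boolP (bad i)) => // bi; case/eqP: ii0; apply: val_inj; apply/eqP.
    by rewrite eqn_leq !badU.
  by rewrite big1 ?ler01// => i _; rewrite none.
have J1 : 1 <= J%:R :> R by rewrite ler1n.
(* Since J >= 1 / (1 - c), the only bad term adds at most 1 to the average, hence the bound 2 +
   1. *)
have : (\sum_(i < J) (bad i)%:R) * (1 - c)^-1 <= 1 * J%:R.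
  by apply: ler_pM => //; rewrite ?invr_ge0 ?(ltW c1')// sumr_ge0.
rewrite mul1r -mulr_natr; lra.
Qed.

(** So far out, every pole lies at a distance from x of at least four times its own size, so each
    term is at most 1/4. *)
Lemma averaged_poles_small x : 5 * 4 ^+ J <= cabs x ->
  cabs (averaged_poles x) <= 4^-1.
Proof.
move=> xJ; apply: averaged_poles_le.
rewrite (_ : 4^-1 * J%:R = \sum_(i < J) 4^-1); last first.
  by rewrite sumr_const card_ord mulr_natr.
apply: ler_sum => i _.
have bJ : b i <= 4 ^+ J by rewrite /b ler_weXn2l ?ler1n// ltnW.
apply: (@pole_le _ _ (4 * b i)); rewrite ?mulr_gt0 ?invr_ge0//.
  by rewrite mulrA mulVf ?mul1r.
rewrite cabsB; apply: le_trans (ler_cabs_dist _ _).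
by rewrite cabs_real gtr0_norm//; lra.
Qed.

End averaged_poles.

(** The order of quantifiers matters: r0 depends on c alone, and the radius B is chosen after it. An
    approximation of [averaged_poles] within 1/8, divided by its value at 0 (of modulus at least
    7/8), turns the bounds 3 and 1/4 into 25/7 <= 4 and 3/7 <= 1/2. *)
Lemma pacman_polynomial (c : R) : 0 < c -> c < 1 ->
  exists2 r0 : R, 0 < r0 & forall B : R, 0 < B ->
  exists2 p : {poly R[i]}, p.[0] = 1 &
  forall x, cabs x <= B -> Re x <= c * cabs x ->
    cabs p.[x] <= 4 /\ (r0 <= cabs x -> cabs p.[x] <= 2^-1).
Proof.
move=> c0 c1; have c1' : 0 < 1 - c by rewrite subr_gt0.
pose J := (Num.bound (1 - c)^-1).+1.
have Jc : (1 - c)^-1 <= J%:R.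
  have cV : 0 <= (1 - c)^-1 by rewrite invr_ge0 ltW.
  by apply: le_trans (ltW (archi_boundP cV)) _; rewrite ler_nat.
exists (5 * 4 ^+ J); first by rewrite mulr_gt0 ?exprn_gt0.
move=> B B0.
have fP : papprox c B (averaged_poles J).
  apply: papproxZ; apply: papprox_sum => i; apply: papproxZ.
  by apply: papprox_inv => //; exact: exprn_gt0.
have e8 : 0 < 8^-1 :> R by rewrite invr_gt0.
have [q qP] := fP _ e8.
have q0 : cabs (1 - q.[0]) <= 8^-1.
  rewrite -(@averaged_poles0 J)//; apply: qP; split; first by rewrite cabs0 ltW.
  by rewrite cabs0 mulr0 lexx.
have q7 : 7 / 8 <= cabs q.[0].
  have := ler_cabs_dist 1 q.[0]; have := ler_cabs_dist 1 (1 - q.[0]).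
  by rewrite cabs1 (_ : 1 - (1 - q.[0]) = q.[0]); [lra|ring].
have q00 : q.[0] != 0 by rewrite -cabs_gt0; lra.
exists ((q.[0])^-1 *: q); first by rewrite hornerZ mulVf.
move=> x xB xc; have Gx : pacman c B x by split.
have M (u : R) : cabs (averaged_poles J x) <= u -> cabs ((q.[0])^-1 *: q).[x] <= 8 / 7 * (u + 8^-1).
  move=> h; rewrite hornerZ cabsM; apply: ler_pM; rewrite ?cabs_ge0//.
    rewrite cabsV -[8 / 7]invrK lef_pV2 ?posrE ?cabs_gt0//; lra.
  have -> : q.[x] = averaged_poles J x - (averaged_poles J x - q.[x]) by ring.
  by apply: le_trans (ler_cabsB _ _) _; rewrite lerD ?qP.
split; first by apply: le_trans (M _ (averaged_poles_bound c0 c1 _ Jc xc)) _ => //; lra.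
move=> xJ; apply: le_trans (M _ (averaged_poles_small _ xJ)) _ => //; lra.
Qed.

End peaking_polynomial.

(** * Greedy choice of signs *)

Section gaussian_functionals.
Variable R : realType.
Implicit Types (x v : R[i]).
Local Open Scope complex_scope.

(** For small y both exponentials are bounded by geometric fractions with sum 2 / (1 - y^2); for y^2
    > 1/2 already |y| <= 2 y^2. *)
Lemma cosh_le (y : R) : expR y + expR (- y) <= 2 * expR (2 * y ^+ 2).
Proof.
have [y1|y1] := leP (y ^+ 2) 2^-1.
  have y2 : -1 < y < 1 by apply/andP; split; nra.
  have h (z : R) : -1 < z -> expR (- z) <= (1 + z)^-1.
    move=> z1; rewrite expRN lef_pV2 ?posrE ?expR_gt0 ?expR_ge1Dx//.
    by rewrite -ltrBlDl sub0r.
  have h1 : expR (- y) <= (1 + y)^-1 by apply: h; case/andP: y2.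
  have h2 : expR y <= (1 - y)^-1.
    by rewrite -{1}[y]opprK; apply: h; rewrite ltrN2; case/andP: y2.
  have h3 : (1 + y)^-1 + (1 - y)^-1 <= 2 * (1 + 2 * y ^+ 2).
    have p1 : 0 < 1 + y by case/andP: y2 => *; lra.
    have p2 : 0 < 1 - y by case/andP: y2 => *; lra.
    have -> : (1 + y)^-1 + (1 - y)^-1 = 2 / ((1 + y) * (1 - y)).
      by field; rewrite !gt_eqF.
    rewrite ler_pdivrMr ?mulr_gt0//.
    have : 0 <= y ^+ 2 by exact: sqr_ge0.
    nra.
  have := expR_ge1Dx (2 * y ^+ 2); lra.
have h (z : R) : z ^+ 2 = y ^+ 2 -> expR z <= expR (2 * y ^+ 2).
  by move=> zy; rewrite ler_expR; nra.
have := h y erefl; have := h (- y) (sqrrN y); lra.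
Qed.

(** The witness r is the real inner product of x and v, and its bound is Cauchy-Schwarz. *)
Lemma cabs_shift_sqr x v : cabs v = 1 -> exists2 r : R, r ^+ 2 <= cabs x ^+ 2 &
  forall s : R, cabs (x + s%:C * v) ^+ 2 = cabs x ^+ 2 + s ^+ 2 + 2 * s * r.
Proof.
move=> v1; exists (Re x * Re v + Im x * Im v).
  have := cabs_sqr v; rewrite v1 expr1n cabs_sqr.
  have : 0 <= (Re x * Im v - Im x * Re v) ^+ 2 by exact: sqr_ge0.
  set a := Re x; set b := Im x; set c := Re v; set d := Im v => h1 h2.
  rewrite -[leRHS]mulr1 {}h2.
  by rewrite -subr_ge0; move: h1; congr (0 <= _); ring.
move=> s; have := cabs_sqr v; rewrite v1 expr1n !cabs_sqr.
case: x v {v1} => [a b] [c d] /= h.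
rewrite [X in _ + X + _](_ : _ = s ^+ 2 * (c ^+ 2 + d ^+ 2)); last by rewrite -h mulr1.
by ring.
Qed.

(** The two terms share the factor exp(l (|x|^2 + s^2)); the cross terms, of opposite signs, give a
    hyperbolic cosine bounded by [cosh_le]. *)
Lemma expR_cabs_avg (l s : R) x v : cabs v = 1 ->
  expR (l * cabs (x + s%:C * v) ^+ 2) + expR (l * cabs (x - s%:C * v) ^+ 2) <=
  2 * expR (l * s ^+ 2 + (l + 8 * l ^+ 2 * s ^+ 2) * cabs x ^+ 2).
Proof.
move=> v1; have [r rx xE] := cabs_shift_sqr x v1.
rewrite xE -mulNr -rmorphN/= xE sqrrN.
set q := cabs x ^+ 2 in rx *; pose y := 2 * l * s * r.
have -> : l * (q + s ^+ 2 + 2 * s * r) = l * (q + s ^+ 2) + y by rewrite /y; ring.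
have -> : l * (q + s ^+ 2 + 2 * - s * r) = l * (q + s ^+ 2) - y by rewrite /y; ring.
rewrite !expRD -mulrDr.
have h : expR y + expR (- y) <= 2 * expR (8 * l ^+ 2 * s ^+ 2 * q).
  apply: le_trans (cosh_le y) _; rewrite ler_pM2l// ler_expR.
  rewrite (_ : 2 * y ^+ 2 = 8 * l ^+ 2 * s ^+ 2 * r ^+ 2); last by rewrite /y; ring.
  by rewrite ler_wpM2l// -mulrA -exprMn mulr_ge0// sqr_ge0.
apply: (@le_trans _ _ (expR (l * (q + s ^+ 2)) * (2 * expR (8 * l ^+ 2 * s ^+ 2 * q)))).
  by rewrite ler_pM2l ?expR_gt0.
rewrite mulrCA ler_pM2l// -!expRD ler_expR.
by rewrite le_eqVlt; apply/orP; left; apply/eqP; ring.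
Qed.

Variables (a b eps : R) (L : nat).
Hypotheses (aL : 8 * eps ^+ 2 * L%:R < a) (bL : 16 * eps ^+ 2 <= b) (b0 : 0 < b).

(* Here j is the number of steps still to be made; the widths solve the recursion
   that makes the functionals supermartingales for random signs, see
   [expR_cabs_avg]. *)
Let aj (j : nat) := a - 8 * eps ^+ 2 * j%:R.
Let bj (j : nat) := b + 16 * eps ^+ 2 * j%:R.
Let eps2 : 0 <= eps ^+ 2. Proof. exact: sqr_ge0. Qed.
Let aj_gt0 j : (j <= L)%N -> 0 < aj j.
Proof.
move=> jL; rewrite subr_gt0; apply: le_lt_trans aL.
by rewrite ler_wpM2l ?ler_nat// mulr_ge0.
Qed.
Let bj_ge j : b <= bj j. Proof. by rewrite lerDl mulr_ge0// mulr_ge0. Qed.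
Let bj_gt0 j : 0 < bj j. Proof. exact: lt_le_trans b0 (bj_ge j). Qed.
Let aj_le j : aj j <= a.
Proof. by rewrite gerBl mulr_ge0// mulr_ge0. Qed.

(** At j = 0 this is exp(- |x|^2 / b), which is at least 1/e on the disc |x|^2 <= b, so its integral
    controls the measure of the set where |x| is small. The first factor records the gain of the
    remaining steps. *)
Definition small_ball_functional j x : R :=
  expR (- \sum_(k < j) eps ^+ 2 / bj k) * expR (- (bj j)^-1 * cabs x ^+ 2).

(** At j = 0 this is exp(|x|^2 / a), whose integral controls the tail of |x|. *)
Definition exp_moment_functional j x : R :=
  expR (\sum_(k < j) eps ^+ 2 / aj k) * expR ((aj j)^-1 * cabs x ^+ 2).

Lemma small_ball_step j x v : cabs v = 1 ->
  small_ball_functional j (x + eps%:C * v) +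
  small_ball_functional j (x - eps%:C * v) <= 2 * small_ball_functional j.+1 x.
Proof.
move=> v1; rewrite /small_ball_functional -mulrDr [2 * _]mulrCA.
rewrite big_ord_recr/= opprD expRD -[leRHS]mulrA ler_pM2l ?expR_gt0//.
apply: le_trans (expR_cabs_avg _ _ _ v1) _.
rewrite mulrCA ler_pM2l// -expRD ler_expR mulNr [_^-1 * _]mulrC lerD2l.
rewrite ler_wpM2r ?sqr_ge0// sqrrN.
have p := bj_gt0 j; have p' := bj_gt0 j.+1; have eps2' := eps2.
have bE : bj j.+1 = bj j + 16 * eps ^+ 2 by rewrite /bj -natr1; ring.
have pe : 16 * eps ^+ 2 <= bj j by exact: le_trans bL (bj_ge j).
rewrite -subr_ge0.
have -> : - (bj j.+1)^-1 - (- (bj j)^-1 + 8 * (bj j)^-1 ^+ 2 * eps ^+ 2) =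
  8 * eps ^+ 2 * (bj j - 16 * eps ^+ 2) / (bj j.+1 * bj j ^+ 2).
  by rewrite bE; field; rewrite -bE !gt_eqF.
apply: divr_ge0; first by rewrite mulr_ge0 ?subr_ge0// mulr_ge0.
by rewrite mulr_ge0 ?sqr_ge0// ltW.
Qed.

Lemma exp_moment_step j x v : (j < L)%N -> cabs v = 1 ->
  exp_moment_functional j (x + eps%:C * v) +
  exp_moment_functional j (x - eps%:C * v) <= 2 * exp_moment_functional j.+1 x.
Proof.
move=> jL v1; rewrite /exp_moment_functional -mulrDr [2 * _]mulrCA.
rewrite big_ord_recr/= expRD -[leRHS]mulrA ler_pM2l ?expR_gt0//.
apply: le_trans (expR_cabs_avg _ _ _ v1) _.
rewrite mulrCA ler_pM2l// -expRD ler_expR (mulrC _ (eps ^+ 2)) lerD2l.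
rewrite ler_wpM2r ?sqr_ge0//.
have p := aj_gt0 (ltnW jL); have p' := aj_gt0 jL; have eps2' := eps2.
have aE : aj j = aj j.+1 + 8 * eps ^+ 2 by rewrite /aj -natr1; ring.
rewrite -subr_ge0.
have -> : (aj j.+1)^-1 - ((aj j)^-1 + 8 * (aj j)^-1 ^+ 2 * eps ^+ 2) =
  8 * eps ^+ 2 * (8 * eps ^+ 2) / (aj j.+1 * aj j ^+ 2).
  by rewrite aE; field; rewrite -aE !gt_eqF.
apply: divr_ge0; first by rewrite mulr_ge0// mulr_ge0.
by rewrite mulr_ge0 ?sqr_ge0// ltW.
Qed.

(** The product telescopes: exp(- 16 eps^2 / b_k) <= b_k / b_{k+1}, because b_{k+1} = b_k + 16
    eps^2. The power 16 makes the exponent match this increment. *)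
Lemma small_ball_gain :
  small_ball_functional L 0 ^+ 16 <= b / (b + 16 * eps ^+ 2 * L%:R).
Proof.
rewrite /small_ball_functional cabs0 expr0n mulr0 expR0 mulr1 -/(bj L).
elim: L => [|j IH]; first by rewrite big_ord0 oppr0 expR0 expr1n /bj mulr0 addr0 divff ?gt_eqF.
rewrite big_ord_recr/= opprD expRD exprMn.
have p := bj_gt0 j; have p' := bj_gt0 j.+1; have eps2' := eps2.
have bE : bj j.+1 = bj j + 16 * eps ^+ 2 by rewrite /bj -natr1; ring.
rewrite (_ : b / bj j.+1 = b / bj j * (bj j / bj j.+1)); last by field; rewrite !gt_eqF.
apply: ler_pM => //; rewrite ?exprn_ge0 ?expR_ge0//.
rewrite -expRM_natl mulrN expRN -[leRHS]invrK lef_pV2 ?posrE ?expR_gt0//; last first.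
  by rewrite invr_gt0 divr_gt0.
rewrite invf_div; apply: le_trans (expR_ge1Dx _).
by rewrite bE mulrDl divff ?gt_eqF// lerD2l le_eqVlt; apply/orP; left; apply/eqP; field; rewrite gt_eqF.
Qed.

Lemma exp_moment_ge j x : (j <= L)%N ->
  expR (a^-1 * cabs x ^+ 2) <= exp_moment_functional j x.
Proof.
move=> jL; rewrite -[leLHS]mul1r; apply: ler_pM; rewrite ?ler01 ?expR_ge0//.
  rewrite -expR0 ler_expR sumr_ge0// => k _.
  by rewrite divr_ge0// ltW// aj_gt0// (leq_trans (ltnW (ltn_ord k))).
have p := aj_gt0 jL.
rewrite ler_expR ler_wpM2r ?sqr_ge0// lef_pV2 ?posrE// ?aj_le//.
exact: lt_le_trans p (aj_le _).
Qed.

Lemma exp_moment_start : exp_moment_functional L 0 <= expR (eps ^+ 2 * L%:R / aj L).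
Proof.
rewrite /exp_moment_functional cabs0 expr0n mulr0 expR0 mulr1 ler_expR.
have p := aj_gt0 (leqnn L).
rewrite (_ : _ / _ = \sum_(k < L) eps ^+ 2 / aj L); last first.
  by rewrite sumr_const card_ord -mulr_natr; ring.
apply: ler_sum => k _; have kL := ltnW (ltn_ord k).
rewrite ler_wpM2l// lef_pV2 ?posrE ?aj_gt0// /aj lerD2l lerN2.
by apply: ler_wpM2l; [exact: mulr_ge0|rewrite ler_nat].
Qed.

End gaussian_functionals.

(** * Exceptional sets of small measure *)

Section small_sets.
Variable R : realType.
Notation mu := (@torus_measure R).
Notation T := (torus R).
Implicit Types (A B : set T) (d : R).

(** Measurability is asked of a cover only, so exceptional sets given by arbitrary conditions can be
    compared by mere inclusion. *)
Definition small d A := exists2 B, measurable B /\ A `<=` B & (mu B <= d%:E)%E.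

Lemma small_sub d d' A A' : A `<=` A' -> d' <= d -> small d' A' -> small d A.
Proof.
move=> AA dd [B [mB AB] muB]; exists B; first by split => //; exact: subset_trans AB.
by apply: le_trans muB _; rewrite lee_fin.
Qed.

Lemma smallU d d' A A' : small d A -> small d' A' -> small (d + d') (A `|` A').
Proof.
move=> [B [mB AB] muB] [B' [mB' AB'] muB']; exists (B `|` B').
  by split; [exact: measurableU|exact: setUSS].
by rewrite EFinD; apply: le_trans (measureU2 _ _ _) (leeD _ _).
Qed.

Lemma small_set0 d : 0 <= d -> small d set0.
Proof. by exists set0; [split|rewrite torus_measure0 lee_fin]. Qed.

Lemma small_markov (g : T -> R) (I b d : R) : 0 < b -> (forall t, 0 <= g t) ->
  measurable_fun setT g -> (\int[mu]_t (g t)%:E <= I%:E)%E -> I / b <= d ->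
  small d [set t | b <= g t].
Proof.
move=> b0 g0 mg gI Ibd; exists [set t | b <= g t].
  by split => //; apply: measurable_ger => //; exact: measurable_cst.
have h := le_trans (markov_torus (ltW b0) g0 mg) gI.
apply: (@le_trans _ _ (I / b)%:E); last by rewrite lee_fin.
by rewrite mulrC EFinM lee_pdivlMl.
Qed.

Lemma small_mu d A : measurable A -> small d A -> (mu A <= d%:E)%E.
Proof.
move=> mA [B [mB AB] muB]; apply: le_trans muB.
by apply: le_measure; rewrite ?inE.
Qed.

End small_sets.

(** * Derandomised choice of the signs *)

Section greedy_signs.
Variable R : realType.
Notation mu := (@torus_measure R).
Notation T := (torus R).
Notation e := (@torus_exp R).
Local Open Scope complex_scope.
Variables (n L : nat) (eps : R) (N : nat -> nat) (F : nat -> R[i] -> R).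
Hypotheses (eps0 : 0 < eps) (F0 : forall i x, 0 <= F i x).
Hypothesis mF : forall i (f : T -> R[i]), cmeasurable f ->
  measurable_fun setT (fun t => F i (f t)).
Hypothesis Fstep : forall i x v, (i < L)%N -> cabs v = 1 ->
  F i.+1 (x + eps%:C * v) + F i.+1 (x - eps%:C * v) <= 2 * F i x.

Let IF i (p : {poly R[i]}) := (\int[mu]_t (F i p.[e n t])%:E)%E.

Let mIF i (p : {poly R[i]}) : measurable_fun setT (fun t => (F i p.[e n t])%:E).
Proof.
apply/measurable_EFinP/mF/cmeasurable_horner; exact: cmeasurable_torus_exp.
Qed.

(** If both signs raised the integral above C, their sum would exceed 2C, against the integrated
    form of [Fstep]. *)
Let greedy_step i (p : {poly R[i]}) (C : R) : (i < L)%N -> (IF i p <= C%:E)%E ->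
  exists2 s, cabs s = eps & (IF i.+1 (p + s *: 'X^(N i)) <= C%:E)%E.
Proof.
move=> iL IC.
have eC : cabs eps%:C = eps by rewrite cabs_real gtr0_norm.
have [|h1] := leP (IF i.+1 (p + eps%:C *: 'X^(N i))) C%:E; first by exists eps%:C.
have [|h2] := leP (IF i.+1 (p + (- eps%:C) *: 'X^(N i))) C%:E.
  by exists (- eps%:C); rewrite ?cabsN.
have h3 := lteD h1 h2.
suff h : (IF i.+1 (p + eps%:C *: 'X^(N i)) +
          IF i.+1 (p + (- eps%:C) *: 'X^(N i)) <= 2%:E * IF i p)%E.
  have := lt_le_trans h3 h.
  have : (2%:E * IF i p <= 2%:E * C%:E)%E by rewrite lee_pmul2l.
  move=> h4 h5; have := lt_le_trans h5 h4.
  by rewrite -EFinD -EFinM lte_fin mulr2n mulrDl mul1r ltxx.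
pose G s t := (F i.+1 (p + s *: 'X^(N i)).[e n t])%:E.
have G0 s t : (0 <= G s t)%E by rewrite lee_fin.
have mG s : measurable_fun setT (G s) by exact: mIF.
have F0' t : (0 <= (F i p.[e n t])%:E)%E by rewrite lee_fin.
pose s1 : R[i] := eps%:C; pose s2 : R[i] := - eps%:C.
rewrite -/(\int[mu]_t G s1 t)%E -/(\int[mu]_t G s2 t)%E.
rewrite -(ge0_integralD mu measurableT (fun t _ => G0 _ t) (mG _)
  (fun t _ => G0 _ t) (mG _)).
rewrite -(ge0_integralZl mu measurableT (mIF i p) (fun t _ => F0' t))//.
have GF t : (G s1 t + G s2 t <= 2%:E * (F i p.[e n t])%:E)%E.
  rewrite /G /s1 /s2.
  rewrite -EFinD -EFinM lee_fin !hornerD !hornerZ !hornerXn mulNr.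
  by apply: Fstep => //; rewrite cabsX cabs_torus_exp expr1n.
apply: (@ge0_le_integral _ _ _ mu setT measurableT (fun t => G s1 t + G s2 t)%E
  (fun t => 2%:E * (F i p.[e n t])%:E)%E).
- by move=> t _; rewrite adde_ge0.
- exact: emeasurable_funD.
- by apply: measurable_funeM; exact: mIF.
- by move=> t _; exact: GF.
Qed.

Lemma greedy_signs : exists w : nat -> {poly R[i]}, [/\ w 0%N = 0,
  (forall i, exists2 s, cabs s = eps & w i.+1 = w i + s *: 'X^(N i)) &
  forall i, (i <= L)%N -> (\int[mu]_t (F i (w i).[e n t])%:E <= (F 0 0)%:E)%E].
Proof.
have /choice[s sP] : forall ip : nat * {poly R[i]}, exists s : R[i],
    cabs s = eps /\ ((ip.1 < L)%N -> (IF ip.1 ip.2 <= (F 0 0)%:E)%E ->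
      (IF ip.1.+1 (ip.2 + s *: 'X^(N ip.1)) <= (F 0 0)%:E)%E).
  move=> [i p] /=.
  (* From step L on only |s| = eps is required, so any sign will do. *)
  have [iL|iL] := ltnP i L; last by exists eps%:C; rewrite cabs_real gtr0_norm.
  have [IC|IC] := pselect (IF i p <= (F 0 0)%:E)%E.
    by have [s se sI] := greedy_step iL IC; exists s.
  by exists eps%:C; rewrite cabs_real gtr0_norm.
pose w := fix w i := if i is i'.+1 then w i' + s (i', w i') *: 'X^(N i') else 0.
exists w; split => //.
  by move=> i; exists (s (i, w i)) => //; have [] := sP (i, w i).
elim=> [_|i IH iL]; last by have [_] := sP (i, w i); apply => //; exact/IH/ltnW.
rewrite le_eqVlt; apply/orP; left; apply/eqP.
rewrite -[RHS]torus_integral_cst; apply: eq_integral => t _.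
by rewrite horner0.
Qed.

End greedy_signs.

(** * A rotation-equivariant polynomial rarely takes values in a thin sector *)

Section sector.
Variable R : realType.
Notation mu := (@torus_measure R).
Notation T := (torus R).
Notation e := (@torus_exp R).
Notation zeta := (unity_root R).
Implicit Types (x z : R[i]) (p w : {poly R[i]}).
Local Open Scope complex_scope.

Lemma unity_root_gap m : exists2 eta : R, 0 < eta <= 1 &
  forall j, (0 < j < m)%N -> Re (zeta m ^+ j) <= 1 - eta.
Proof.
suff [eta e01 h] : exists2 eta : R, 0 < eta <= 1 & forall j, (j < m)%N ->
    (0 < j)%N -> Re (zeta m ^+ j) <= 1 - eta.
  by exists eta => // j /andP[j0 jm]; exact: h.
have : (m <= m)%N by []; move: {-2 4}m => k; elim: k => [|k IH] km.
  by exists 1 => //; rewrite ltr01 lexx.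
have [eta /andP[e0 e1] h] := IH (ltnW km).
have [->|k0] := posnP k.
  by exists eta; rewrite ?e0// => -[|j].
have hk : 0 < 1 - Re (zeta m ^+ k).
  by rewrite subr_gt0 Re_unity_root_lt1// k0.
exists (Num.min eta (1 - Re (zeta m ^+ k))).
  by rewrite lt_min e0 hk ge_min e1.
move=> j; rewrite ltnS leq_eqVlt => /orP[/eqP -> _|jk j0].
  by rewrite lerBrDr -lerBrDl ge_min lexx orbT.
apply: le_trans (h j jk j0) _.
by rewrite lerD2l lerN2 ge_min lexx.
Qed.

(** Two points of modulus r in the thin sector are both close to r, hence to each other, so the
    rotation z between them is close to 1. *)
Lemma sector_rotation (eta : R) x z : 0 < eta -> cabs z = 1 ->
  (1 - eta / 8) * cabs x < Re x -> (1 - eta / 8) * cabs x < Re (z * x) ->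
  1 - eta < Re z.
Proof.
move=> eta0 z1; have := cabs_sqr x; have := cabs_sqr z; rewrite z1 expr1n.
have := cabs_ge0 x; have := ler_Re_cabs x.
case: x => p q; case: z {z1} => s t /=.
set r := cabs _ => pr r0 st pq.
set k := 1 - eta / 8 => h1 h2.
have rpos : 0 < r.
  rewrite lt_neqAle r0 andbT eq_sym; apply/eqP => rE.
  by move: pr h1; rewrite rE mulr0 normr_le0 => /eqP ->; rewrite ltxx.
have r2 : 0 < r ^+ 2 by rewrite exprn_gt0.
(* |zr - r|^2 <= 2 |zr - zx|^2 + 2 |zx - r|^2 *)
have h3 : r ^+ 2 * (2 - 2 * s) <=
    2 * (2 * r ^+ 2 - 2 * r * p) + 2 * (2 * r ^+ 2 - 2 * r * (s * p - t * q)).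
  have : 0 <= (s * r - 2 * (s * p - t * q) + r) ^+ 2 +
              (t * r - 2 * (s * q + t * p)) ^+ 2.
    by rewrite addr_ge0 ?sqr_ge0.
  have -> : (s * r - 2 * (s * p - t * q) + r) ^+ 2 +
              (t * r - 2 * (s * q + t * p)) ^+ 2 =
    (s ^+ 2 + t ^+ 2) * r ^+ 2 + 4 * ((s ^+ 2 + t ^+ 2) * (p ^+ 2 + q ^+ 2)) +
    r ^+ 2 - 4 * r * p * (s ^+ 2 + t ^+ 2) + 2 * s * r ^+ 2
     - 4 * r * (s * p - t * q) by ring.
  by rewrite -st -pq; lra.
have h4 : r * (k * r) < r * p by rewrite ltr_pM2l.
have h5 : r * (k * r) < r * (s * p - t * q) by rewrite ltr_pM2l.
have h6 : r ^+ 2 * (2 - 2 * s) < r ^+ 2 * eta.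
  have -> : r ^+ 2 * eta = 8 * r ^+ 2 - 8 * (r * (k * r)) by rewrite /k; field.
  lra.
rewrite ltr_pM2l// in h6; lra.
Qed.

(** By equivariance and the gap, at most one of the m rotated values lies in the sector: the rotated
    indicators sum to at most 1, and [rotation_bound] gives 1/m. *)
Lemma small_sector n m (eta : R) w : (0 < n)%N -> (0 < m)%N -> 0 < eta ->
  (forall j, (0 < j < m)%N -> Re (zeta m ^+ j) <= 1 - eta) ->
  (forall z j, w.[zeta m ^+ j * z] = zeta m ^+ j * w.[z]) ->
  small (m%:R^-1) [set t | (1 - eta / 8) * cabs w.[e n t] < Re w.[e n t]].
Proof.
move=> n0 m0 eta0 gap wrot.
pose S x : bool := (1 - eta / 8) * cabs x < Re x.
pose g z : R := (S w.[z])%:R.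
have mw : cmeasurable (fun t => w.[e n t]).
  by apply: cmeasurable_horner; exact: cmeasurable_torus_exp.
have mS : measurable [set t | S w.[e n t]].
  apply: measurable_gtr; last exact: mw.1.
  by apply: measurable_funM; [exact: measurable_cst|exact: measurable_cabs].
have gE : (fun t => g (e n t)) = \1_[set t | S w.[e n t]].
  apply/funext => t; rewrite /g indicE; congr (_%:R); congr nat_of_bool.
  by apply/idP/idP => h; rewrite inE in h *.
have mg : measurable_fun setT (fun t => g (e n t)).
  by rewrite gE; exact: measurable_indic.
have g0 z : 0 <= g z by [].
have gI : (\int[mu]_t (g (e n t))%:E <= (1 / m%:R)%:E)%E.
  apply: rotation_bound => // t.
  have uniq (i j : 'I_m) : S (w.[zeta m ^+ i * e n t]) ->
      S (w.[zeta m ^+ j * e n t]) -> (j <= i)%N.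
    rewrite !wrot; set x := w.[e n t] => Si Sj.
    rewrite leqNgt; apply/negP => ij.
    have jE : zeta m ^+ j = zeta m ^+ (j - i) * zeta m ^+ i.
      by rewrite -exprD subnK// ltnW.
    have cE k : cabs (zeta m ^+ k * x) = cabs x.
      by rewrite cabsM cabsX cabs_unity_root expr1n mul1r.
    have ji : (0 < j - i < m)%N.
      by rewrite subn_gt0 ij (leq_ltn_trans (leq_subr _ _)).
    have := gap _ ji; rewrite leNgt => /negP; apply.
    apply: (@sector_rotation _ (zeta m ^+ i * x)) => //.
      by rewrite cabsX cabs_unity_root expr1n.
    by rewrite mulrA -jE cE -(cE j).
  rewrite /g; case: (pickP (fun i : 'I_m => S (w.[zeta m ^+ i * e n t]))) => [i0 Si0|none].
    rewrite (bigD1 i0)//= [X in _ + X]big1 ?addr0 ?lern1 ?leq_b1// => i ii0.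
    case: (boolP (S _)) => // Si; case/eqP: ii0; apply: val_inj; apply/eqP.
    by rewrite eqn_leq !uniq.
  by rewrite big1 ?ler01// => i _; rewrite none.
apply: (small_sub _ _ (small_markov ltr01 (fun t => g0 _) mg gI (lexx _))).
  by move=> t /= St; rewrite /g /S St.
by rewrite divr1 div1r.
Qed.

End sector.

(** * The kernel *)

Section kernel.
Variable R : realType.
Notation mu := (@torus_measure R).
Notation T := (torus R).
Notation e := (@torus_exp R).
Notation zeta := (unity_root R).
Implicit Types (x z : R[i]) (p q w : {poly R[i]}).
Local Open Scope complex_scope.

(** For v a monomial of high degree, this shows that passing from w to w + v leaves all lower
    coefficients of the composition unchanged. *)
Lemma comp_poly_increment p w v : exists q, p \Po (w + v) = p \Po w + q * v.
Proof.
elim/poly_ind: p => [|p c [q IH]]; first by exists 0; rewrite !comp_poly0 mul0r addr0.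
exists (q * (w + v) + (p \Po w)).
by rewrite !comp_polyD !comp_polyM !comp_polyX !comp_polyC IH; ring.
Qed.

Lemma exprn_le_expR (y : R) D : 0 <= y -> y ^+ D <= D%:R ^+ D * expR y.
Proof.
move=> y0; case: D => [|D]; first by rewrite !expr0 mul1r -expR0 ler_expR.
have D0 : 0 < D.+1%:R :> R by rewrite ltr0n.
have -> : expR y = expR (y / D.+1%:R) ^+ D.+1.
  by rewrite -expRM_natl mulrC divfK// gt_eqF.
rewrite -exprMn lerXn2r ?nnegrE ?mulr_ge0 ?expR_ge0//.
rewrite -ler_pdivrMl// mulrC; apply: le_trans (expR_ge1Dx _).
by rewrite lerDr.
Qed.

(** From (1 + r)^2 <= 2a (1 + r^2) / a, followed by [exprn_le_expR]; the final + 1 only makes the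
    constant positive. *)
Lemma exp_domination (K a : R) D : 0 < a -> exists2 K2 : R, 0 < K2 &
  forall x, (K * (1 + cabs x) ^+ D) ^+ 2 <= K2 * expR (a^-1 * cabs x ^+ 2).
Proof.
move=> a0; pose c := D%:R ^+ D * (2 * a) ^+ D * expR a^-1.
have c0 : 0 <= c by rewrite !mulr_ge0 ?exprn_ge0 ?expR_ge0// mulr_ge0// ltW.
exists (K ^+ 2 * c + 1); first by rewrite ltr_wpDl// mulr_ge0// sqr_ge0.
move=> x; set r := cabs x; have r0 : 0 <= r by exact: cabs_ge0.
apply: (@le_trans _ _ (K ^+ 2 * c * expR (a^-1 * r ^+ 2))); last first.
  by rewrite ler_wpM2r ?expR_ge0// lerDl.
rewrite exprMn -mulrA ler_wpM2l ?sqr_ge0// -exprM mulnC exprM.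
have y0 : 0 <= a^-1 * (1 + r ^+ 2).
  by rewrite mulr_ge0 ?invr_ge0 ?(ltW a0)// addr_ge0// sqr_ge0.
apply: (@le_trans _ _ ((2 * a) ^+ D * (a^-1 * (1 + r ^+ 2)) ^+ D)).
  rewrite -exprMn lerXn2r ?nnegrE ?sqr_ge0//.
    by rewrite mulr_ge0// mulr_ge0// ltW.
  rewrite mulrA -(mulrA 2) divff ?gt_eqF// mulr1.
  by have := sqr_ge0 (1 - r); nra.
rewrite (_ : c * _ = (2 * a) ^+ D * (D%:R ^+ D * expR (a^-1 * (1 + r ^+ 2)))).
  by rewrite ler_wpM2l ?exprn_le_expR// exprn_ge0// mulr_ge0// ltW.
by rewrite mulrDr mulr1 expRD /c; ring.
Qed.

(** * From lacunary sums to a kernel with controlled partial sums *)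

Section construction.
Variables (delta : R) (n : nat).
Hypotheses (delta0 : 0 < delta) (n0 : (0 < n)%N).

Definition good_kernel (H : {poly R[i]}) :=
  [/\ H`_0 = 1, forall j, (0 < j)%N -> cabs H`_j <= delta,
      small delta [set t | 2^-1 < cabs H.[e n t]] &
      forall M, small delta [set t | 5 < cabs (take_poly M H).[e n t]]].

Variables (Phi : {poly R[i]}) (m : nat) (w : nat -> {poly R[i]}) (L : nat).
(** The base of the frequencies g^i. It is 1 modulo m, which yields the rotation equivariance, and
    it exceeds the degree of [Phi], which keeps the degree of [U i] below g^i. *)
Let g := (1 + m * size Phi)%N.
Hypothesis m0 : (0 < m)%N.
Hypothesis w0 : w 0%N = 0.
Hypothesis wS : forall i, exists s, w i.+1 = w i + s *: 'X^(g ^ i).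
Let U i := Phi \Po w i.

Lemma block_rotation i z j : (w i).[zeta m ^+ j * z] = zeta m ^+ j * (w i).[z].
Proof.
elim: i => [|i IH]; first by rewrite w0 !horner0 mulr0.
have [s ->] := wS i; rewrite !hornerD !hornerZ !hornerXn IH exprMn.
have -> : (zeta m ^+ j) ^+ (g ^ i) = zeta m ^+ j.
  have [k ->] : exists k, (g ^ i = 1 + m * k)%N.
    elim: (i) => [|i' [k gk]]; first by exists 0%N; rewrite muln0.
    by exists (size Phi + k + size Phi * (m * k))%N; rewrite expnS gk /g; ring.
  by rewrite exprD expr1 -!exprM mulnC -mulnA exprM unity_root_expn// expr1n mulr1.
by ring.
Qed.

Lemma size_block i : (0 < size Phi)%N -> (size (w i) <= g ^ i.-1 + (i != 0))%N.
Proof.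
move=> Phi0; elim: i => [|i IH]; first by rewrite w0 size_poly0.
have [s ->] := wS i; apply: leq_trans (size_polyD _ _) _; rewrite geq_max; apply/andP; split.
  apply: leq_trans IH _; rewrite addn1; case: i => [//|i] /=.
  by rewrite addn1 ltnS leq_exp2l// /g; lia.
by apply: leq_trans (size_scale_leq _ _) _; rewrite size_polyXn addn1.
Qed.

Lemma size_comp_block i : (0 < size Phi)%N -> (size (U i) <= g ^ i)%N.
Proof.
move=> Phi0; apply: leq_trans (size_comp_poly_leq _ _) _.
have := size_block i Phi0; case: i => [|i] /=.
  by rewrite w0 size_poly0 => _; rewrite muln0.
rewrite addn1 => h; have h2 : ((size (w i.+1)).-1 <= g ^ i)%N.
  by case: (size _) h => [|k].
have gi : (0 < g ^ i)%N by rewrite expn_gt0.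
have Sg : ((size Phi).-1 < g)%N.
  by rewrite prednK// /g (leq_trans _ (leq_addl _ _))// leq_pmull.
rewrite expnS.
apply: (@leq_ltn_trans ((size Phi).-1 * g ^ i)); first by rewrite leq_mul2l h2 orbT.
by rewrite ltn_mul2r gi Sg.
Qed.

(** [U i] has degree below g^i and [U i.+1 - U i] is a multiple of X^(g^i), so each [U i] is a
    partial sum of all later ones. *)
Lemma take_comp_block i : (0 < size Phi)%N -> take_poly (g ^ i) (U i.+1) = U i.
Proof.
move=> Phi0; have [s wE] := wS i; rewrite /U wE.
have [q ->] := comp_poly_increment Phi (w i) (s *: 'X^(g ^ i)).
by rewrite -scalerAr scalerAl take_polyDMXn// size_comp_block.
Qed.

(** A partial sum cut inside block i is [U i], bounded by 4 outside the sector and the tail, plus a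
    truncation of [U i.+1 - U i], which Parseval and Markov keep below 1 off a small set; hence 5.
    Here [r0] is the aperture constant of the sector. *)
Lemma good_kernel_comp (B r0 theta : R) :
  Phi.[0] = 1 -> theta <= delta / 4 -> theta <= delta ^+ 2 ->
  (forall i, (i < L)%N -> l2sq (U i.+1 - U i) <= theta) ->
  (forall x, cabs x <= B -> Re x <= r0 * cabs x -> cabs Phi.[x] <= 4) ->
  (forall i, (i <= L)%N -> small (delta / 4) [set t | r0 * cabs (w i).[e n t] < Re (w i).[e n t]]) ->
  (forall i, (i <= L)%N -> small (delta / 4) [set t | B < cabs (w i).[e n t]]) ->
  small (delta / 4) [set t | 2^-1 < cabs Phi.[(w L).[e n t]] /\
     ((w L).[e n t] \in [pred x | cabs x <= B & Re x <= r0 * cabs x])] ->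
  good_kernel (U L).
Proof.
move=> Phi1 th1 th2 Ul2 PhiB smS smB smL.
have Phi0 : (0 < size Phi)%N.
  rewrite size_poly_gt0; apply/eqP => P0; move/eqP: Phi1.
  by rewrite P0 horner0 eq_sym oner_eq0.
have U0 : U 0%N = 1 by rewrite /U w0 comp_poly0r -horner_coef0 Phi1.
have UE i t : (U i).[e n t] = Phi.[(w i).[e n t]] by rewrite horner_comp.
have d2 : 0 <= delta by exact: ltW.
have cover i : (i <= L)%N -> small (delta / 2) ([set t | B < cabs (w i).[e n t]] `|`
    [set t | r0 * cabs (w i).[e n t] < Re (w i).[e n t]]).
  move=> iL; apply: (small_sub _ _ (smallU (smB i iL) (smS i iL))) => //; lra.
split.
- suff : forall i, (U i)`_0 = 1 by apply.
  elim=> [|i IH]; first by rewrite U0 coef1.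
  by rewrite -IH -(take_comp_block i Phi0) coef_take_poly expn_gt0.
- suff : forall i, (i <= L)%N -> forall j, (0 < j)%N -> cabs (U i)`_j <= delta.
    by apply.
  elim=> [_ j j0|i IH iL j j0].
    by rewrite U0 coef1 gtn_eqF// cabs0.
  have [jg|jg] := ltnP j (g ^ i).
    by have := IH (ltnW iL) j j0; rewrite -(take_comp_block i Phi0) coef_take_poly jg.
  have -> : (U i.+1)`_j = (U i.+1 - U i)`_j.
    by rewrite coefB [(U i)`_j]nth_default ?subr0// (leq_trans (size_comp_block i Phi0)).
  (* A coefficient in the new block is bounded by the L^2 norm of the increment. *)
  rewrite -(@ler_pXn2r _ 2) ?nnegrE ?cabs_ge0//.
  apply: le_trans (l2sq_coef _ _) (le_trans (Ul2 i iL) th2).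
- have h := smallU (cover L (leqnn _)) smL.
  apply: (small_sub _ _ h); last by lra.
  move=> t /=; rewrite UE => h1.
  have [h2|h2] := ltP B (cabs (w L).[e n t]); first by left; left.
  have [h3|h3] := ltP (r0 * cabs (w L).[e n t]) (Re (w L).[e n t]); first by left; right.
  by right; split => //; rewrite inE/= h2 h3.
suff : forall i, (i <= L)%N -> forall M, small delta [set t | 5 < cabs (take_poly M (U i)).[e n t]].
  by apply.
elim=> [_ M|i IH iL M].
  apply: (small_sub _ _ (small_set0 d2)) => // t /=; rewrite U0.
  case: M => [|M]; first by rewrite take_poly0l horner0 cabs0 ltNge ler0n.
  by rewrite take_poly_id ?size_poly1// hornerC cabs1 ltNge ler1n.
have [Mg|Mg] := leqP M (g ^ i).
  have -> : take_poly M (U i.+1) = take_poly M (U i).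
    rewrite -(take_comp_block i Phi0); apply/polyP => j.
    by rewrite !coef_take_poly; case: ifP => // jM; rewrite (leq_trans jM Mg).
  exact: IH (ltnW iL) M.
have ME : take_poly M (U i.+1) = U i + take_poly M (U i.+1 - U i).
  rewrite -[X in _ = X + _](@take_poly_id _ M (U i)); last first.
    exact: leq_trans (size_comp_block i Phi0) (ltnW Mg).
  by rewrite -take_polyD addrC subrK.
have iL' := ltnW iL.
have sm1 : small (delta / 4) [set t | 1 <= cabs (take_poly M (U i.+1 - U i)).[e n t] ^+ 2].
  apply: (small_markov ltr01 _ (measurable_sqr_horner n _)).
  - by move=> t; exact: sqr_ge0.
  - by rewrite parseval//; exact: lexx.
  - by rewrite divr1; apply: le_trans (l2sq_take _ _) (le_trans (Ul2 i iL) th1).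
apply: (small_sub _ _ (smallU (cover i iL') sm1)); last by lra.
move=> t /=; rewrite ME hornerD UE => h1.
have [h2|h2] := ltP B (cabs (w i).[e n t]); first by left; left.
have [h3|h3] := ltP (r0 * cabs (w i).[e n t]) (Re (w i).[e n t]); first by left; right.
right; have := PhiB _ h2 h3; have := ler_cabsD Phi.[(w i).[e n t]] (take_poly M (U i.+1 - U i)).[e n t].
set u := cabs _.[e n t]; move=> h4 h5.
have u1 : 1 <= u by lra.
by rewrite -[1](expr1n _ 2) lerXn2r ?nnegrE// (le_trans _ u1).
Qed.

End construction.
End kernel.

(** * Choice of the parameters and existence of the kernel *)

Section kernel_existence.
Variable R : realType.
Notation mu := (@torus_measure R).
Notation T := (torus R).
Notation e := (@torus_exp R).
Implicit Types (x z : R[i]) (p q w : {poly R[i]}).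
Local Open Scope complex_scope.

Lemma torus_le_integral (f g : T -> R) : measurable_fun setT f ->
  measurable_fun setT g -> (forall t, 0 <= f t) -> (forall t, f t <= g t) ->
  (\int[mu]_t (f t)%:E <= \int[mu]_t (g t)%:E)%E.
Proof.
move=> mf mg f0 fg.
apply: (@ge0_le_integral _ _ _ mu setT measurableT (fun t => (f t)%:E)
  (fun t => (g t)%:E)).
- by move=> t _; rewrite lee_fin.
- exact/measurable_EFinP.
- exact/measurable_EFinP.
- by move=> t _; rewrite lee_fin.
Qed.

Lemma measurable_expR_cabs (l : R) (f : T -> R[i]) : cmeasurable f ->
  measurable_fun setT (fun t => expR (l * cabs (f t) ^+ 2)).
Proof.
move=> mf; have mg : measurable_fun setT (fun t => l * cabs (f t) ^+ 2).
  apply: measurable_funM; first exact: measurable_cst.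
  by apply: measurable_funX; exact: measurable_cabs.
exact: (measurableT_comp (@measurable_expR R) mg).
Qed.

Lemma kernel_exists (delta : R) n : 0 < delta -> (0 < n)%N ->
  exists H, good_kernel delta n H.
Proof.
move=> d0 n0; have d4 : 0 < delta / 4 by rewrite divr_gt0.
(* Four exceptional events share the budget: each gets delta / 4, and 1/m is the measure lost to the
   sector. *)
have [m m0 md] : exists2 m : nat, (0 < m)%N & m%:R^-1 <= delta / 4 :> R.
  exists (Num.bound (delta / 4)^-1).+1 => //.
  rewrite -[leRHS]invrK lef_pV2 ?posrE ?invr_gt0//.
  have dV : 0 <= (delta / 4)^-1 by rewrite invr_ge0 ltW.
  by apply: le_trans (ltW (archi_boundP dV)) _; rewrite ler_nat.
have [eta /andP[eta0 eta1] gap] := unity_root_gap R m.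
pose c := 1 - eta / 8.
have c0 : 0 < c by rewrite /c; lra.
have c1 : c < 1 by rewrite /c; lra.
have [r0 r00 PhiP] := pacman_polynomial c0 c1.
(* The Gaussian width matches the disc |x| < r0, where [Phi] need not be small. *)
pose b := r0 ^+ 2; have b0 : 0 < b by rewrite exprn_gt0.
(* [k] bounds the initial value of F: the weighted small-ball functional starts below 1 and the
   exponential moment below exp(1/8). *)
pose k : R := 1 + expR 8^-1; have k0 : 0 < k by rewrite addr_gt0// expR_gt0.
(* Chosen so that the last Markov inequality, at level e^{-1} / s, gives k s e = delta / 4. *)
pose s := delta / 4 * (k * expR 1)^-1.
have s0 : 0 < s by rewrite mulr_gt0// invr_gt0 mulr_gt0// expR_gt0.
(* The total variance eps^2 L: it makes b / (b + 16 V) at most s^16, so [small_ball_gain] bounds the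
   initial small-ball functional by s. *)
pose V := b / s ^+ 16; have V0 : 0 < V by rewrite divr_gt0// exprn_gt0.
(* The moment width then decreases from 16 V to 8 V only, and the initial exponent is V / (8 V) =
   1/8. *)
pose a := 16 * V; have a0 : 0 < a by rewrite mulr_gt0.
(* Large enough for exp(B^2 / a) >= k / (delta / 4), so that Markov bounds the tail |w_i| > B by
   delta / 4. *)
pose B := 1 + a * (k / (delta / 4)).
have B1 : 1 <= B by rewrite lerDl mulr_ge0 ?divr_ge0 ?ltW.
have [Phi Phi0 PhiB] := PhiP B (lt_le_trans ltr01 B1).
have [K [D [K0 PhiK]]] := poly_growth Phi.
have [K2 K20 domK2] := exp_domination K D a0.
pose theta := Num.min (delta / 4) (delta ^+ 2).
have th0 : 0 < theta by rewrite lt_min d4 exprn_gt0.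
(* The three bounds on eps^2 serve respectively the increment estimate of [Phi], the small-ball
   recursion, and the L^2 size of each block. *)
pose rho := Num.min 1 (Num.min (b / 16) (theta / (K2 * k))).
have rho0 : 0 < rho by rewrite !lt_min ltr01 !divr_gt0// mulr_gt0.
have [L [eps [eps0 epsL]]] : exists L : nat, exists eps : R,
    [/\ 0 < eps, eps ^+ 2 * L%:R = V & eps ^+ 2 <= rho].
  pose L := (Num.bound (V / rho)).+1.
  have LR : 0 < L%:R :> R by rewrite ltr0n.
  exists L, (Num.sqrt (V / L%:R)).
  have -> : Num.sqrt (V / L%:R) ^+ 2 = V / L%:R by rewrite sqr_sqrtr// divr_ge0 ?ltW.
  rewrite sqrtr_gt0 divr_gt0// divfK ?gt_eqF//; split => //.
  rewrite ler_pdivrMr// mulrC -ler_pdivrMr//.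
  have VV : 0 <= V / rho by rewrite divr_ge0 ?ltW.
  by apply: le_trans (ltW (archi_boundP VV)) _; rewrite ler_nat.
rewrite !le_min => /and3P[eps_1 eps_b eps_th].
have aL : 8 * eps ^+ 2 * L%:R < a by rewrite -mulrA epsL /a; lra.
have bL : 16 * eps ^+ 2 <= b by lra.
pose psi := small_ball_functional b eps.
pose chi := exp_moment_functional a eps.
(* The greedy choice counts the steps already made, the functionals those that remain. *)
pose F i x := psi (L - i)%N x / s + chi (L - i)%N x.
have psi0 j x : 0 <= psi j x by rewrite mulr_ge0 ?expR_ge0.
have chi0 j x : 0 <= chi j x by rewrite mulr_ge0 ?expR_ge0.
have psis0 j x : 0 <= psi j x / s by rewrite divr_ge0 ?psi0 ?ltW.
have F0 i x : 0 <= F i x by rewrite addr_ge0.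
have mpsi j f : cmeasurable f -> measurable_fun setT (fun t : T => psi j (f t)).
  move=> mf; apply: measurable_funM; first exact: measurable_cst.
  exact: measurable_expR_cabs.
have mpsis j f : cmeasurable f -> measurable_fun setT (fun t : T => psi j (f t) / s).
  by move=> mf; apply: measurable_funM; [exact: mpsi|exact: measurable_cst].
have mF i f : cmeasurable f -> measurable_fun setT (fun t : T => F i (f t)).
  move=> mf; apply: measurable_funD; first exact: mpsis.
  apply: measurable_funM; first exact: measurable_cst.
  exact: measurable_expR_cabs.
have Fstep i x v : (i < L)%N -> cabs v = 1 ->
    F i.+1 (x + eps%:C * v) + F i.+1 (x - eps%:C * v) <= 2 * F i x.
  move=> iL v1; rewrite /F -(subnSK iL).
  rewrite addrACA mulrDr; apply: lerD.
    rewrite -mulrDl mulrA ler_pM2r ?invr_gt0//.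
    exact: small_ball_step.
  apply: exp_moment_step aL _ _ _ _ v1.
  by rewrite (subnSK iL) leq_subr.
have Fstart : F 0%N 0 <= k.
  rewrite /F subn0; apply: lerD.
    rewrite ler_pdivrMr// mul1r -(@ler_pXn2r _ 16) ?nnegrE ?psi0 ?(ltW s0)//.
    apply: le_trans (small_ball_gain _ _ _) _ => //.
    have den : 0 < b + 16 * V.
      by apply: addr_gt0 => //; apply: mulr_gt0.
    rewrite -mulrA epsL ler_pdivrMr// /V.
    have s16 : s ^+ 16 != 0 by rewrite expf_neq0 ?gt_eqF.
    rewrite (_ : s ^+ 16 * _ = s ^+ 16 * b + 16 * b); last first.
      by field; rewrite gt_eqF.
    have : 0 <= s ^+ 16 * b by rewrite mulr_ge0 ?exprn_ge0 ?ltW.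
    lra.
  have h := exp_moment_start aL; apply: le_trans h _.
  rewrite ler_expR -(mulrA 8) epsL.
  rewrite (_ : V / _ = 8^-1)// /a; field.
  by rewrite gt_eqF//=; lra.
have [w [w0 wS wI]] := greedy_signs n (fun i => (1 + m * size Phi) ^ i)%N eps0 F0 mF Fstep.
have {}wI i : (i <= L)%N -> (\int[mu]_t (F i (w i).[e n t])%:E <= k%:E)%E.
  by move=> iL; apply: le_trans (wI i iL) _; rewrite lee_fin.
have mw i : cmeasurable (fun t => (w i).[e n t]).
  by apply: cmeasurable_horner; exact: cmeasurable_torus_exp.
pose E i t := expR (a^-1 * cabs (w i).[e n t] ^+ 2).
have mE i : measurable_fun setT (E i) by exact: measurable_expR_cabs.
have E0 i t : 0 <= E i t by exact: expR_ge0.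
have EI i : (i <= L)%N -> (\int[mu]_t (E i t)%:E <= k%:E)%E.
  move=> iL; apply: le_trans (wI i iL).
  apply: (@torus_le_integral (E i) (fun t => F i (w i).[e n t])).
  - exact: mE.
  - exact/mF/mw.
  - exact: E0.
  move=> t; rewrite /F -[leLHS]add0r; apply: lerD; first exact: psis0.
  by have := exp_moment_ge aL (w i).[e n t] (leq_subr i L).
exists (Phi \Po w L).
have wS' i : exists s : R[i], w i.+1 = w i + s *: 'X^((1 + m * size Phi) ^ i).
  by have [u _ wE] := wS i; exists u.
apply: (@good_kernel_comp R delta n d0 n0 Phi m w L m0 w0 wS' B c theta Phi0).
- by rewrite ge_min lexx.
- by rewrite ge_min lexx orbT.
- move=> i iL; rewrite -lee_fin -(parseval _ n0).
  (* The increment is at most eps K (1 + |w_i|)^D pointwise; its square is dominated by the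
     exponential moment, whose integral is at most k. *)
  apply: (@le_trans _ _ (\int[mu]_t (eps ^+ 2 * K2 * E i t)%:E)%E).
    apply: (@torus_le_integral _ (fun t => eps ^+ 2 * K2 * E i t)).
    + exact: measurable_sqr_horner.
    + by apply: measurable_funM; [exact: measurable_cst|exact: mE].
    + by move=> t; exact: sqr_ge0.
    + move=> t; have [u ue wE] := wS i.
      rewrite hornerD hornerN !horner_comp wE hornerD hornerZ hornerXn.
      set h := _ * _; set x := (w i).[e n t].
      have hE : cabs h = eps by rewrite cabsM ue cabsX cabs_torus_exp expr1n mulr1.
      have h1 : cabs h <= 1.
        by rewrite hE -(@ler_pXn2r _ 2) ?nnegrE ?(ltW eps0)// expr1n.
      have [_ ] := PhiK x h h1; rewrite hE => PhiK1.
      apply: (@le_trans _ _ ((eps * (K * (1 + cabs x) ^+ D)) ^+ 2)).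
        by rewrite lerXn2r ?nnegrE ?cabs_ge0// (le_trans _ PhiK1)// cabs_ge0.
      by rewrite exprMn -mulrA ler_wpM2l ?sqr_ge0//; exact: domK2.
  under eq_integral do rewrite EFinM.
  have mEE : measurable_fun setT (fun t => (E i t)%:E) by exact/measurable_EFinP/mE.
  have EE0 (t : T) : setT t -> (0 <= (E i t)%:E)%E by move=> _; rewrite lee_fin.
  have eK0 : (0 <= (eps ^+ 2 * K2)%:E)%E.
    by rewrite lee_fin mulr_ge0 ?sqr_ge0// ltW.
  rewrite (ge0_integralZl mu measurableT mEE EE0 eK0).
  apply: (@le_trans _ _ ((eps ^+ 2 * K2)%:E * k%:E)%E).
    by apply: lee_wpmul2l => //; exact/EI/ltnW.
  by rewrite -EFinM lee_fin -mulrA -ler_pdivlMr// mulr_gt0.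
- by move=> x xB xc; have [] := PhiB x xB xc.
- move=> i iL; have := @small_sector R n m eta (w i) n0 m0 eta0 gap.
  move=> h; apply: (small_sub (fun _ => id) md); apply: h => z j.
  exact: (block_rotation (Phi := Phi) (m := m)).
- move=> i iL.
  have h : expR (a^-1 * B ^+ 2) >= k / (delta / 4).
    apply: le_trans (expR_ge1Dx _).
    have : k / (delta / 4) <= a^-1 * B.
      by rewrite ler_pdivlMl// /B; lra.
    have : a^-1 * B <= a^-1 * B ^+ 2.
      by rewrite ler_pM2l ?invr_gt0// expr2 ler_peMr// (le_trans ler01 B1).
    lra.
  apply: (@small_sub _ (delta / 4) (k / expR (a^-1 * B ^+ 2)) _
    [set t | expR (a^-1 * B ^+ 2) <= E i t]).
  + move=> t /= Bt; rewrite ler_expR ler_pM2l ?invr_gt0//.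
    by rewrite lerXn2r ?nnegrE ?cabs_ge0 ?(le_trans ler01 B1)// ltW.
  + by rewrite ler_pdivrMr ?expR_gt0// mulrC -ler_pdivrMr.
  + exact: small_markov (expR_gt0 _) (E0 i) (mE i) (EI i iL) (lexx _).
- have psiI : (\int[mu]_t (psi 0%N (w L).[e n t] / s)%:E <= k%:E)%E.
    apply: le_trans (wI L (leqnn L)).
    apply: (@torus_le_integral (fun t => psi 0%N (w L).[e n t] / s)
      (fun t => F L (w L).[e n t])).
    + exact/mpsis/mw.
    + exact/mF/mw.
    + by move=> t; exact: psis0.
    + by move=> t; rewrite /F subnn lerDl.
  have q0 : 0 < expR (-1) / s by rewrite divr_gt0// expR_gt0.
  apply: small_sub _ (lexx _) (small_markov q0 (fun t => psis0 _ _) (mpsis _ _ (mw L)) psiI _).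
    move=> t /= [h1]; rewrite inE/= => /andP[xB xc].
    rewrite ler_pM2r ?invr_gt0// /psi /small_ball_functional big_ord0 oppr0 expR0 mul1r.
    rewrite mulr0 addr0 ler_expR mulNr lerN2 mulrC ler_pdivrMr// mul1r.
    have [_] := PhiB _ xB xc.
    have [r0x|xr0] := leP r0 (cabs (w L).[e n t]).
      by move=> /(_ isT); rewrite leNgt h1.
    by move=> _; rewrite /b lerXn2r ?nnegrE ?cabs_ge0 ?(ltW r00)// ltW.
  rewrite invf_div expRN invrK /s.
  rewrite (_ : k * _ = delta / 4)//; field.
  by rewrite !gt_eqF ?expR_gt0.
Qed.

End kernel_existence.

(** * Density of trigonometric polynomials in measure *)

Section trigonometric_approximation.
Variable R : realType.
Notation mu := (@torus_measure R).
Notation T := (torus R).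
Notation e := (@torus_exp R).
Implicit Types (f g h : T -> R[i]) (A : set T).
Local Open Scope complex_scope.

(** Continuity from above of a finite measure. *)
Lemma small_cvg (D : (set T)^nat) (d : R) : 0 < d ->
  (forall n, measurable (D n)) -> (forall n m, (n <= m)%N -> D m `<=` D n) ->
  \bigcap_n D n = set0 -> exists n, small d (D n).
Proof.
move=> d0 mD Dle D0.
have fin : (mu (D 0%N) < +oo)%E.
  apply: (@le_lt_trans _ _ 1%E); last by rewrite ltry.
  rewrite -(torus_measure_setT R); apply: le_measure; rewrite ?inE//.
have niD : nonincreasing_seq D by move=> n m nm; apply/subsetPset; exact: Dle.
have mI : measurable (\bigcap_n D n) by rewrite D0.
have := @nonincreasing_cvg_mu _ _ _ mu D fin mD mI niD.
rewrite D0 [X in _ --> X](_ : _ = 0%E); last exact: torus_measure0.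
move=> /fine_cvgP[fD /cvgrPdist_lt /(_ _ d0)[n _ nP]].
case: fD => m _ mP; pose k := maxn n m; exists k.
have := nP k (leq_maxl _ _); rewrite /= sub0r normrN => h.
have fk := mP k (leq_maxr _ _).
exists (D k); first by split.
rewrite -[leLHS]fineK//= lee_fin.
exact: le_trans (ler_norm _) (ltW h).
Qed.

Definition trigonometric h := exists K Q, forall t, h t = Q.[e 1 t] / e 1 t ^+ K.

Lemma trigonometric_cst c : trigonometric (fun=> c).
Proof. by exists 0%N, c%:P => t; rewrite hornerC expr0 divr1. Qed.

Lemma trigonometricD g h : trigonometric g -> trigonometric h ->
  trigonometric (fun t => g t + h t).
Proof.
move=> [K [P gE]] [M [Q hE]]; exists (K + M)%N, (P * 'X^M + Q * 'X^K) => t.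
rewrite gE hE hornerD !hornerM !hornerXn exprD.
by field; rewrite !expf_neq0// torus_exp_neq0.
Qed.

Lemma trigonometricM g h : trigonometric g -> trigonometric h ->
  trigonometric (fun t => g t * h t).
Proof.
move=> [K [P gE]] [M [Q hE]]; exists (K + M)%N, (P * Q) => t.
rewrite gE hE hornerM exprD.
by field; rewrite !expf_neq0// torus_exp_neq0.
Qed.

Lemma trigonometric_exp n : trigonometric (e n).
Proof. by exists 0%N, 'X^n => t; rewrite hornerXn expr0 divr1 -torus_exp1X. Qed.

Lemma trigonometric_expV n : trigonometric (fun t => (e n t)^-1).
Proof. by exists n, 1 => t; rewrite hornerC div1r -torus_exp1X. Qed.

Lemma trigonometric_bounded h : trigonometric h ->
  exists2 M : R, 0 < M & forall t, cabs (h t) <= M.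
Proof.
move=> [K [Q hE]]; have [k [D [k0 kP]]] := poly_growth Q.
exists (k * (1 + 1) ^+ D + 1) => [|t].
  by rewrite ltr_wpDl// mulr_ge0// exprn_ge0.
have [] := kP (e 1 t) 0; first by rewrite cabs0.
rewrite hE cabsM cabsV cabsX cabs_torus_exp expr1n invr1 mulr1 => h1 _.
by apply: le_trans h1 _; rewrite lerDl.
Qed.

Lemma trigonometric_measurable h : trigonometric h -> cmeasurable h.
Proof.
move=> [K [Q hE]].
have -> : h = fun t => Q.[e 1 t] * (conjc (e 1 t)) ^+ K.
  apply/funext => t; rewrite hE; congr (_ * _).
  by rewrite -exprVn torus_expV.
apply: cmeasurableM; first exact: (cmeasurable_horner Q (cmeasurable_torus_exp R 1)).
have [m1 m2] := cmeasurable_torus_exp R 1.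
have mc : cmeasurable (fun t : T => conjc (e 1 t)).
  by split; [exact: m1|exact: measurable_funN m2].
elim: K {hE} => [|K IH].
  by under eq_fun do rewrite expr0; exact: cmeasurable_cst.
by under eq_fun do rewrite exprS; exact: cmeasurableM.
Qed.

(** Membership in the closure of the trigonometric polynomials for convergence in measure; a single
    d bounds both the error and the exceptional set. *)
Definition tapprox g := forall d : R, 0 < d ->
  exists2 h, trigonometric h & small d [set t | d < cabs (g t - h t)].

Lemma tapprox_trigonometric h : trigonometric h -> tapprox h.
Proof.
move=> hT d d0; exists h => //.
apply: (small_sub _ (lexx _) (small_set0 (ltW d0))) => t /=.
by rewrite subrr cabs0 ltNge ltW.
Qed.

Lemma tapprox_lim f : (forall d : R, 0 < d ->
  exists2 g, tapprox g & small d [set t | d < cabs (f t - g t)]) -> tapprox f.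
Proof.
move=> fP d d0; have d2 : 0 < d / 2 by rewrite divr_gt0.
have [g gP fg] := fP _ d2; have [h hT gh] := gP _ d2; exists h => //.
apply: (small_sub _ _ (smallU fg gh)); last by rewrite -splitr.
move=> t /= fh; apply/orP; rewrite -[_ || _]negbK negb_or -!leNgt.
apply/negP => /andP[h1 h2]; move: fh; rewrite ltNge => /negP; apply.
rewrite -(subrK (g t) (f t)) -addrA [d]splitr.
exact: le_trans (ler_cabsD _ _) (lerD h1 h2).
Qed.

Lemma tapproxD f g : tapprox f -> tapprox g -> tapprox (fun t => f t + g t).
Proof.
move=> fP gP d d0; have d2 : 0 < d / 2 by rewrite divr_gt0.
have [h hT fh] := fP _ d2; have [k kT gk] := gP _ d2.
exists (fun t => h t + k t); first exact: trigonometricD.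
apply: (small_sub _ _ (smallU fh gk)); last by rewrite -splitr.
move=> t /= fgt; apply/orP; rewrite -[_ || _]negbK negb_or -!leNgt.
apply/negP => /andP[h1 h2]; move: fgt; rewrite ltNge => /negP; apply.
rewrite opprD addrACA [d]splitr.
exact: le_trans (ler_cabsD _ _) (lerD h1 h2).
Qed.

(** From fg - hk = (f - h) g + h (g - k). The order of choices matters: g is first bounded by B off
    a small set, then h is chosen according to B, then k according to the bound H of h. *)
Lemma tapproxM f g : tapprox f -> tapprox g -> tapprox (fun t => f t * g t).
Proof.
move=> fP gP d d0; have d4 : 0 < d / 4 by rewrite divr_gt0.
have [g0 g0T gg0] := gP _ d4; have [M M0 gM] := trigonometric_bounded g0T.
(* off a small set, |g| <= M + d / 4 *)
pose B := M + d / 4; have B0 : 0 < B by rewrite addr_gt0.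
have d1 : 0 < Num.min (d / 4) (d / 2 / B) by rewrite lt_min d4 !divr_gt0.
have [h hT fh] := fP _ d1; have [H H0 hH] := trigonometric_bounded hT.
have d5 : 0 < Num.min (d / 4) (d / 2 / H) by rewrite lt_min d4 !divr_gt0.
have [k kT gk] := gP _ d5.
exists (fun t => h t * k t); first exact: trigonometricM.
apply: (small_sub _ _ (smallU gg0 (smallU fh gk))); last first.
  have : Num.min (d / 4) (d / 2 / B) <= d / 4 by rewrite ge_min lexx.
  have : Num.min (d / 4) (d / 2 / H) <= d / 4 by rewrite ge_min lexx.
  lra.
move=> t /= fgt; have [h1|h1] := ltP (d / 4) (cabs (g t - g0 t)); first by left.
right; have [h2|h2] := ltP (Num.min (d / 4) (d / 2 / B)) (cabs (f t - h t)).
  by left.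
have [h3|h3] := ltP (Num.min (d / 4) (d / 2 / H)) (cabs (g t - k t)); first by right.
exfalso; move: fgt; rewrite ltNge => /negP; apply.
have gB : cabs (g t) <= B.
  rewrite -(subrK (g0 t) (g t)) /B addrC.
  exact: le_trans (ler_cabsD _ _) (lerD (gM t) h1).
rewrite (_ : _ - _ = (f t - h t) * g t + h t * (g t - k t)); last by ring.
apply: le_trans (ler_cabsD _ _) _; rewrite !cabsM [d]splitr; apply: lerD.
  apply: (@le_trans _ _ (d / 2 / B * B)); last by rewrite divfK// gt_eqF.
  apply: ler_pM; rewrite ?cabs_ge0//.
  by apply: le_trans h2 _; rewrite ge_min lexx orbT.
apply: (@le_trans _ _ (H * (d / 2 / H))); last by rewrite mulrC divfK// gt_eqF.
apply: ler_pM; rewrite ?cabs_ge0//.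
by apply: le_trans h3 _; rewrite ge_min lexx orbT.
Qed.

Lemma tapprox_cst c : tapprox (fun=> c).
Proof. exact/tapprox_trigonometric/trigonometric_cst. Qed.

Lemma tapproxZ c f : tapprox f -> tapprox (fun t => c * f t).
Proof. exact/tapproxM/tapprox_cst. Qed.

Lemma tapprox_sum I (s : seq I) (f : I -> T -> R[i]) :
  (forall i, tapprox (f i)) -> tapprox (fun t => \sum_(i <- s) f i t).
Proof.
move=> fP; elim: s => [|i s IH].
  by under eq_fun do rewrite big_nil; exact: tapprox_cst.
by under eq_fun do rewrite big_cons; exact: tapproxD.
Qed.

(* The iterates of this odd polynomial converge to the sign function on [-1, 1]. *)
Definition sign_step (x : R) : R := (3 * x - x ^+ 3) / 2.

Lemma sign_stepN x : sign_step (- x) = - sign_step x.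
Proof. by rewrite /sign_step; field. Qed.

Lemma iter_sign_stepN n x : iter n sign_step (- x) = - iter n sign_step x.
Proof. by elim: n => //= n ->; rewrite sign_stepN. Qed.

(** On [eta, 1] the map increases y, and 1 - y is multiplied by 1 - y (1 + y) / 2 <= 1 - eta / 2. *)
Lemma iter_sign_step_pos n (eta x : R) : 0 < eta -> eta <= x -> x <= 1 ->
  eta <= iter n sign_step x <= 1 /\ 1 - iter n sign_step x <= (1 - eta / 2) ^+ n.
Proof.
move=> e0 ex x1; elim: n => [|n [/andP[IH1 IH2] IH3]]/=.
  by split; [apply/andP; split => //|rewrite expr0; lra].
set y := iter n _ x in IH1 IH2 IH3 *.
have y0 : 0 < y by lra.
have h1 : y <= sign_step y.
  rewrite -subr_ge0 (_ : _ - _ = y * ((1 - y) * (1 + y)) / 2); last first.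
    by rewrite /sign_step; field.
  by rewrite divr_ge0// mulr_ge0 ?(ltW y0)// mulr_ge0 ?subr_ge0//
    addr_ge0 ?(ltW y0).
have h2 : 1 - sign_step y = (1 - y) * (1 - y * (1 + y) / 2).
  by rewrite /sign_step; field.
have h3 : 0 <= 1 - y * (1 + y) / 2 <= 1 - eta / 2.
  by apply/andP; split; nra.
have h4 : 0 <= 1 - sign_step y.
  rewrite h2; case/andP: h3 => h3 _.
  by apply: mulr_ge0 => //; rewrite subr_ge0.
split; first by apply/andP; split; lra.
rewrite exprSr h2; apply: ler_pM => //; first by rewrite subr_ge0.
  by case/andP: h3.
by case/andP: h3.
Qed.

Lemma iter_sign_step n (eta x : R) : 0 < eta -> eta <= 1 -> `|x| <= 1 ->
  x = 0 \/ eta <= `|x| -> `|Num.sg x - iter n sign_step x| <= (1 - eta / 2) ^+ n.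
Proof.
move=> e0 e1 x1; have [x0|x0|->] := ltrgt0P x.
- move=> [xE|ex]; first by rewrite xE ltxx in x0.
  rewrite gtr0_sg//; rewrite gtr0_norm// in x1 ex.
  by have [/andP[_ h1] h2] := iter_sign_step_pos n e0 ex x1; rewrite ger0_norm ?subr_ge0.
- move=> [xE|ex]; first by rewrite xE ltxx in x0.
  rewrite ltr0_sg// -[x in iter _ _ x]opprK iter_sign_stepN -opprD normrN.
  rewrite ltr0_norm// in x1 ex.
  have [/andP[_ h1] h2] := iter_sign_step_pos n e0 ex x1.
  by rewrite ger0_norm ?subr_ge0.
- move=> _; rewrite sgr0.
  have -> : iter n sign_step 0 = 0.
    by elim: n => //= n ->; rewrite /sign_step expr0n mulr0 subr0 mul0r.
  by rewrite subrr normr0 exprn_ge0//; lra.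
Qed.

(** The iterates of [sign_step] at g are trigonometric polynomials close to the sign except where 0
    < |g| < 1 / (k + 1). These sets shrink to the empty set; the zeros of g are harmless because 0
    is a fixed point. *)
Lemma tapprox_sg (g : T -> R) : trigonometric (fun t => (g t)%:C) ->
  (forall t, `|g t| <= 1) -> tapprox (fun t => (Num.sg (g t))%:C).
Proof.
move=> gT g1.
have mg : measurable_fun setT g by have [] := trigonometric_measurable gT.
have mng : measurable_fun setT (fun t => `|g t|).
  exact: (measurableT_comp (@normr_measurable R setT) mg).
apply: tapprox_lim => d d0.
pose D k := [set t | 0 < `|g t|] `&` [set t | `|g t| < k.+1%:R^-1].
have [k Dk] : exists k, small d (D k).
  apply: small_cvg => //.
  - move=> k; apply: measurableI.
      by apply: measurable_gtr => //; exact: measurable_cst.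
    by apply: measurable_gtr => //; exact: measurable_cst.
  - move=> n m nm t [h1 h2]; split => //; apply: lt_le_trans h2 _.
    by rewrite lef_pV2 ?posrE ?ltr0n// ler_nat.
  - apply/seteqP; split => // t h; have [h1 _] := h 0%N I.
    have [_ /=] := h (Num.bound (`|g t|^-1)) I.
    rewrite ltNge => /negP; apply.
    rewrite -[leRHS]invrK lef_pV2 ?posrE ?invr_gt0//.
    have gV : 0 <= `|g t|^-1 by rewrite invr_ge0.
    by apply: le_trans (ltW (archi_boundP gV)) _; rewrite ler_nat.
pose eta : R := k.+1%:R^-1.
have e0 : 0 < eta by rewrite invr_gt0.
have e1 : eta <= 1 by rewrite invf_le1// ler1n.
have [n nd] : exists n, (1 - eta / 2) ^+ n <= d.
  have : `|1 - eta / 2| < 1 by rewrite ger0_norm; lra.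
  move=> /cvg_expr /cvgrPdist_lt /(_ _ d0)[n _ /(_ n (leqnn n))].
  rewrite /= sub0r normrN => h; exists n.
  exact: le_trans (ler_norm _) (ltW h).
exists (fun t => (iter n sign_step (g t))%:C).
  apply: tapprox_trigonometric; elim: n {nd} => //= n IH.
  have -> : (fun t => (sign_step (iter n sign_step (g t)))%:C) =
    (fun t => (iter n sign_step (g t))%:C * ((3 / 2)%:C + (- 2^-1)%:C *
      ((iter n sign_step (g t))%:C * (iter n sign_step (g t))%:C))).
    apply/funext => t; rewrite -!rmorphM -rmorphD -rmorphM; congr (_%:C).
    by rewrite /sign_step; field.
  apply: trigonometricM => //; apply: trigonometricD; first exact: trigonometric_cst.
  apply: trigonometricM; first exact: trigonometric_cst.
  exact: trigonometricM.
apply: (small_sub _ (lexx _) Dk) => t /=.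
rewrite -rmorphB/= cabs_real => h; split => /=.
  rewrite normr_gt0; apply/eqP => g0; move: h; rewrite ltNge => /negP; apply.
  by apply: le_trans nd; apply: iter_sign_step => //; left.
rewrite ltNge; apply/negP => eg; move: h; rewrite ltNge => /negP; apply.
by apply: le_trans nd; apply: iter_sign_step => //; right.
Qed.

End trigonometric_approximation.

(** * From rays to Borel sets, Lebesgue sets and all measurable functions *)

Section measurable_approximation.
Variable R : realType.
Notation mu := (@torus_measure R).
Notation T := (torus R).
Notation e := (@torus_exp R).
Notation pi2 := (2 * pi : R).
Implicit Types (A : set T) (X : set R).
Local Open Scope complex_scope.

Let pi2_gt0 : 0 < pi2. Proof. by rewrite mulr_gt0// pi_gt0. Qed.

(** The representative in [0, 2 pi[: a measurable section of [to_torus], whereas [repr] is an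
    arbitrary one. *)
Definition angle (t : T) : R :=
  repr t - (Num.floor (repr t / pi2))%:~R * pi2.

Lemma angle_to_torus x :
  angle (to_torus x) = x - (Num.floor (x / pi2))%:~R * pi2.
Proof.
have /eq_to_torus[k] : to_torus (repr (to_torus x)) = to_torus x.
  by rewrite /to_torus reprK.
rewrite /angle => /eqP; rewrite subr_eq => /eqP ->.
rewrite (_ : (k%:~R * pi2 + x) / pi2 = x / pi2 + k%:~R); last first.
  by rewrite mulrDl addrC mulfK// lt0r_neq0.
rewrite floorDrz ?intr_int// intrKfloor intrD; ring.
Qed.

Lemma to_torus_angle t : to_torus (angle t) = t.
Proof.
have [x <-] := to_torus_surj t; rewrite angle_to_torus; apply/eq_to_torus.
by exists (- Num.floor (x / pi2)); rewrite rmorphN/=; ring.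
Qed.

Lemma angle_ge0 t : 0 <= angle t.
Proof. by rewrite subr_ge0 -ler_pdivlMr// floor_le. Qed.

Lemma angle_lt t : angle t < pi2.
Proof.
have := floorD1_gt (repr t / pi2).
by rewrite ltr_pdivrMr// intrD mulrDl mul1r /angle ltrBlDr addrC.
Qed.

Lemma angle_id x : 0 <= x -> x < pi2 -> angle (to_torus x) = x.
Proof.
move=> x0 x1; rewrite angle_to_torus (_ : Num.floor _ = 0) ?mul0r ?subr0//.
apply/eqP; rewrite floor_eq add0r; apply/andP; split; first by rewrite divr_ge0// ltW.
by rewrite ltr_pdivrMr// mul1r.
Qed.

Lemma measurable_angle : measurable_fun setT angle.
Proof.
apply: (@measurable_torus_fun _ (fun x => x - (Num.floor (x / pi2))%:~R * pi2)); last first.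
  exact: angle_to_torus.
apply: measurable_funB => //; apply: measurable_funM => //.
apply: nondecreasing_measurable => // x y xy.
by rewrite ler_int le_floor// ler_pM2r ?invr_gt0.
Qed.

Definition indicator A (t : T) : R[i] := (t \in A)%:R.

Definition approximable A := tapprox (indicator A).

Lemma approximableC A : approximable A -> approximable (~` A).
Proof.
move=> hA; rewrite /approximable (_ : indicator _ =
    (fun t => 1 + (-1) * indicator A t)).
  by apply: tapproxD; [exact: tapprox_cst|exact: tapproxZ].
apply/funext => t; rewrite /indicator in_setC.
by case: (t \in A) => /=; rewrite ?mulr1 ?mulr0 ?subrr ?addr0.
Qed.

Lemma approximableI A B : approximable A -> approximable B ->
  approximable (A `&` B).
Proof.
move=> hA hB; rewrite /approximable (_ : indicator _ =
    (fun t => indicator A t * indicator B t)); first exact: tapproxM.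
by apply/funext => t; rewrite /indicator in_setI; case: (_ \in A);
  rewrite ?mul1r ?mul0r.
Qed.

Lemma approximable_lim A : (forall d : R, 0 < d ->
  exists2 B, approximable B & small d ((A `\` B) `|` (B `\` A))) ->
  approximable A.
Proof.
move=> hA; apply: tapprox_lim => d d0; have [B hB AB] := hA d d0.
exists (indicator B) => //; apply: (small_sub _ (lexx _) AB) => t /=.
rewrite /indicator; case: (boolP (t \in A)) => tA; case: (boolP (t \in B)) => tB;
  rewrite ?subrr ?cabs0 => h.
- by rewrite ltNge ltW in h.
- by left; rewrite inE in tA; rewrite notin_setE in tB.
- by right; rewrite notin_setE in tA; rewrite inE in tB.
- by rewrite ltNge ltW in h.
Qed.

Lemma approximable_setT : approximable setT.
Proof.
rewrite /approximable (_ : indicator _ = (fun=> 1)); first exact: tapprox_cst.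
by apply/funext => t; rewrite /indicator in_setT.
Qed.

(** Finite unions are handled by complements and intersections, and what they miss of the full union
    decreases to the empty set. *)
Lemma approximable_bigcup (F : (set T)^nat) : (forall n, measurable (F n)) ->
  (forall n, approximable (F n)) -> approximable (\bigcup_n F n).
Proof.
move=> mF hF; pose G n := \bigcup_(i < n) F i.
have mG n : measurable (G n) by exact: bigcup_measurable.
have hG n : approximable (G n).
  elim: n => [|n IH].
    rewrite /G (_ : \bigcup_(_ < _) _ = ~` setT).
      exact/approximableC/approximable_setT.
    by rewrite setCT; apply/seteqP; split => // t [].
  rewrite (_ : G n.+1 = ~` (~` G n `&` ~` F n)).
    by apply: approximableC; apply: approximableI; exact: approximableC.
  rewrite setCI !setCK; apply/seteqP; split => t.
    move=> [i /=]; rewrite ltnS leq_eqVlt => /orP[/eqP ->|iln] Fit; first by right.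
    by left; exists i.
  move=> [[i /= iln] Fit|Fnt]; first by exists i => //=; exact: ltnW.
  by exists n => /=.
apply: approximable_lim => d d0.
pose D n := (\bigcup_i F i) `\` G n.
have [n Dn] : exists n, small d (D n).
  apply: small_cvg => //.
  - by move=> n; apply: measurableD => //; exact: bigcupT_measurable.
  - move=> n m nm t [h1 h2]; split => // -[i /= iln Fi]; apply: h2.
    by exists i => //=; exact: leq_trans nm.
  - apply/seteqP; split => // t h; have [[i _ Fi] _] := h 0%N I.
    by have [_] := h i.+1 I; apply; exists i => /=.
exists (G n) => //; apply: (small_sub _ (lexx _) Dn) => t [//|[[i iln Fi] h]].
by exfalso; apply: h; exists i.
Qed.

Lemma sin_lt0_pi (x : R) : - pi < x -> x < pi -> (sin x < 0) = (x < 0).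
Proof.
move=> x1 x2; have [x0|x0|->] := ltrgt0P x; last by rewrite sin0 ltxx.
  by apply/negbTE; rewrite -leNgt ltW// sin_gt0_pi// x0.
by rewrite -oppr_gt0 -sinN sin_gt0_pi// oppr_gt0 x0/= ltrNl.
Qed.

Lemma approximable_ray (s : R) : approximable (angle @^-1` `]s, +oo[%classic).
Proof.
have [s0|s0] := ltP s 0.
  rewrite (_ : _ @^-1` _ = setT); first exact: approximable_setT.
  apply/seteqP; split => // t _ /=; rewrite in_itv/= andbT.
  exact: lt_le_trans s0 (angle_ge0 t).
have [s1|s1] := leP pi2 s.
  rewrite (_ : _ @^-1` _ = ~` setT); first exact/approximableC/approximable_setT.
  rewrite setCT; apply/seteqP; split => // t /=; rewrite in_itv/= andbT ltNge.
  by rewrite (le_trans (ltW (angle_lt t)) s1).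
(* g < 0 exactly when the angle exceeds s *)
pose g (t : T) : R := (cos (angle t - s / 2) - cos (s / 2)) / 2.
have gE t : g t = sin (angle t / 2) * sin ((s - angle t) / 2).
  rewrite /g; set r := angle t.
  have -> : r - s / 2 = r / 2 - (s - r) / 2 by field.
  have -> : s / 2 = r / 2 + (s - r) / 2 by field.
  by rewrite cosB cosD; field.
have g1 t : `|g t| <= 1.
  rewrite gE normrM -[1]mulr1; apply: ler_pM => //; exact: sin_max.
have g_lt0 t : (g t < 0) = (s < angle t).
  rewrite gE; set r := angle t.
  have r0 : 0 <= r by exact: angle_ge0.
  have r1 : r < pi2 by exact: angle_lt.
  have [rE|rN] := eqVneq r 0.
    by rewrite rE mul0r sin0 mul0r ltxx ltNge s0.
  have rp : 0 < r by rewrite lt_neqAle eq_sym rN.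
  rewrite pmulr_rlt0; last by apply: sin_gt0_pi; apply/andP; split; lra.
  rewrite sin_lt0_pi; [|lra|lra].
  by apply/idP/idP => h; lra.
have gT : trigonometric (fun t => (g t)%:C).
  pose a : R[i] := (cos (s / 2) +i* sin (s / 2)).
  rewrite (_ : (fun t => _) = (fun t => 4^-1 * (a * (e 1 t)^-1 + conjc a * e 1 t)
    + (- (cos (s / 2) / 2))%:C)).
    apply: trigonometricD; last exact: trigonometric_cst.
    apply: trigonometricM; first exact: trigonometric_cst.
    apply: trigonometricD; apply: trigonometricM.
    - exact: trigonometric_cst.
    - exact: trigonometric_expV.
    - exact: trigonometric_cst.
    - exact: trigonometric_exp.
  apply/funext => t.
  have eE : e 1 t = cos (angle t) +i* sin (angle t).
    by rewrite -[in LHS](to_torus_angle t) torus_expE mul1r.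
  rewrite torus_expV eE /g cosB.
  have -> : 4^-1 = (4^-1)%:C :> R[i] by rewrite fmorphV/= rmorph_nat.
  by apply/eqP; rewrite eq_complex/=; apply/andP; split; apply/eqP; field.
(* The indicator of g < 0 is (sg^2 - sg) / 2. *)
rewrite /approximable (_ : indicator _ = (fun t => (2^-1)%:C *
  ((Num.sg (g t))%:C * (Num.sg (g t))%:C + (-1) * (Num.sg (g t))%:C))).
  have sgT := tapprox_sg gT g1.
  by apply: tapproxZ; apply: tapproxD; [exact: tapproxM|exact: tapproxZ].
apply/funext => t; rewrite /indicator.
have -> : (t \in angle @^-1` `]s, +oo[%classic) = (g t < 0).
  by rewrite g_lt0; apply/idP/idP; rewrite inE/= in_itv/= andbT.
case: ltrgt0P => [h|h|h].
- by rewrite gtr0_sg// mulr1 mulN1r subrr mulr0.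
- rewrite ltr0_sg//; apply/eqP; rewrite eq_complex/=.
  by apply/andP; split; apply/eqP; field.
- by rewrite h sgr0 !mulr0 addr0 mulr0.
Qed.

Lemma approximable_borel (X : set (measurableTypeR R)) : measurable X ->
  approximable (angle @^-1` X).
Proof.
have -> : @measurable _ (measurableTypeR R) = <<s @RGenOInfty.G R >>.
  exact: RGenOInfty.measurableE.
move: X; suff : <<s @RGenOInfty.G R >> `<=`
    [set X | measurable (angle @^-1` X) /\ approximable (angle @^-1` X)].
  by move=> h X /h[].
apply: smallest_sub.
  split.
  - rewrite /= preimage_set0; split => //.
    by rewrite -setCT; exact/approximableC/approximable_setT.
  - move=> X [mX hX] /=; rewrite setTD -preimage_setC; split.
      exact: measurableC.
    exact: approximableC.
  - move=> F hF /=; rewrite preimage_bigcup; split.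
      by apply: bigcupT_measurable => n; have [] := hF n.
    by apply: approximable_bigcup => n; have [] := hF n.
move=> _ [x ->] /=; split; last exact: approximable_ray.
by rewrite -[_ @^-1` _]setTI; apply: measurable_angle.
Qed.

(** The lifted set is a Borel set up to a null set, which is invisible in measure. *)
Lemma approximable_measurable A : measurable A -> approximable A.
Proof.
move=> mA.
have : measurable (@to_torus R @^-1` A : set (lebesgueR R)).
  by rewrite -measurable_torusE.
rewrite /lebesgueR -completed_caratheodory_measurable.
rewrite g_sigma_completed_algebra_genE => -[Y mY [N [N' [mN' N'0 NN']]] YN].
apply: approximable_lim => d d0; exists (angle @^-1` Y).
  exact: approximable_borel.
exists (angle @^-1` N').
  split; first by rewrite -[_ @^-1` _]setTI; apply: measurable_angle.
  have AE t : A t <-> (Y (angle t) \/ N (angle t)).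
    have : (@to_torus R @^-1` A) (angle t) = (Y `|` N) (angle t) by rewrite YN.
    by rewrite /= to_torus_angle => ->.
  move=> t [[/AE[Yt|Nt] nY]|[Yt nA]] //=; first exact: NN'.
  by exfalso; apply: nA; apply/AE; left.
rewrite /torus_measure (_ : completed_lebesgue_measure _ = 0%E) ?mule0 ?lee_fin ?ltW//.
apply/eqP; rewrite eq_le measure_ge0 andbT -N'0.
apply: le_outer_measure => x /= [h]; rewrite in_itv/= => /andP[x0 x1].
by move: h; rewrite angle_id.
Qed.

(** The sum counts the multiples of d passed by x, so d times it rounds x down to the grid, capped
    at n d. *)
Lemma staircase (d x : R) n : 0 < d -> 0 <= x -> x <= n.+1%:R * d ->
  `|x - d * \sum_(j < n) ((j.+1%:R * d <= x)%R)%:R| <= d.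
Proof.
move=> d0 x0; elim: n => [|n IH] xn.
  by rewrite big_ord0 mulr0 subr0 ger0_norm// -[d]mul1r.
rewrite big_ord_recr/=; have [h|h] := leP (n.+1%:R * d) x; last first.
  by rewrite addr0; apply: IH; exact: ltW.
rewrite (eq_bigr (fun=> 1)).
  rewrite sumr_const card_ord -natrD addn1 mulrC.
  rewrite ger0_norm ?subr_ge0// lerBlDr -{1}[d]mul1r -mulrDl.
  by move: xn; rewrite -natr1 addrC.
move=> j _; have hj : j.+1%:R * d <= n.+1%:R * d.
  by rewrite ler_pM2r// ler_nat ltnS ltnW.
by rewrite (le_trans hj h).
Qed.

(** Off a small set |u| < k; there u + k lies in [0, 2k] and is within d of a staircase of
    indicators of measurable sets. *)
Lemma tapprox_real (u : T -> R) : measurable_fun setT u ->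
  tapprox (fun t => (u t)%:C).
Proof.
move=> mu_; apply: tapprox_lim => d d0.
pose D k := [set t | k%:R <= `|u t|].
have [k Dk] : exists k, small d (D k).
  apply: small_cvg => //.
  - move=> k; apply: measurable_ger; first exact: measurable_cst.
    exact: (measurableT_comp (@normr_measurable R setT) mu_).
  - by move=> n m nm t /=; apply: le_trans; rewrite ler_nat.
  - apply/seteqP; split => // t h; have := h (Num.bound `|u t|) I; rewrite /D/=.
    by rewrite leNgt archi_boundP.
have [n nk] : exists n, 2 * k%:R <= n.+1%:R * d.
  exists (Num.bound (2 * k%:R / d)); rewrite -ler_pdivrMr//.
  have kd : 0 <= 2 * k%:R / d by rewrite divr_ge0// ltW.
  by apply: le_trans (ltW (archi_boundP kd)) _; rewrite ler_nat.
pose A j := [set t | j.+1%:R * d <= u t + k%:R].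
have mA j : measurable (A j).
  apply: measurable_ger; first exact: measurable_cst.
  by apply: measurable_funD => //; exact: measurable_cst.
exists (fun t => d%:C * (\sum_(j < n) indicator (A j) t) + (- k%:R)%:C).
  apply: tapproxD; last exact: tapprox_cst.
  apply: tapproxZ; apply: tapprox_sum => j.
  exact: approximable_measurable.
apply: (small_sub _ (lexx _) Dk) => t /= h; rewrite /D/= leNgt; apply/negP => uk.
move: h; rewrite ltNge => /negP; apply.
have -> : d%:C * (\sum_(j < n) indicator (A j) t) + (- k%:R)%:C =
    (d * \sum_(j < n) ((j.+1%:R * d <= u t + k%:R)%R)%:R - k%:R)%:C.
  rewrite rmorphB rmorphM rmorph_sum/= rmorphN; congr (_ * _ + _).
  apply: eq_bigr => j _; rewrite rmorph_nat /indicator; congr (_%:R).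
  by congr nat_of_bool; apply/idP/idP; rewrite inE.
rewrite -rmorphB cabs_real.
have := ler_norm (u t); have := ler_norm (- u t); rewrite normrN => h1 h2.
have := @staircase d (u t + k%:R) n d0.
set S := d * _; rewrite opprB addrA.
by apply; lra.
Qed.

Lemma tapprox_measurable (f : T -> R[i]) : cmeasurable f -> tapprox f.
Proof.
move=> [m1 m2].
rewrite (_ : f = (fun t => (Re (f t))%:C + 'i * (Im (f t))%:C)).
  by apply: tapproxD; [|apply: tapproxZ]; exact: tapprox_real.
by apply/funext => t; rewrite -complexE.
Qed.

Lemma L0_cmeasurable (f : T -> R[i]) : L0 f -> cmeasurable f.
Proof.
move=> mf.
have openRe (h : R[i] -> R) : (forall x y, `|h x - h y| <= cabs (x - y)) ->
    measurable_fun setT (fun t => h (f t)).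
  (* For a Lipschitz h the preimage of an open ray is open in the complex plane; real and imaginary
     parts are such h. *)
  move=> hlip; apply: (measurability _ (RGenOInfty.measurableE R)).
  move=> _ [_ [x ->] <-]; rewrite setTI.
  have oU : open ([set z | x < h z] : set R[i]^o).
    rewrite openE => z /= xz; rewrite /interior.
    apply/nbhs_ballP; exists (h z - x)%:C => /=.
      by rewrite ltcR subr_gt0.
    move=> y zy; have {}zy : cabs (z - y) < h z - x by rewrite -ltcR -norm_cabs.
    have := le_lt_trans (le_trans (ler_norm _) (hlip z y)) zy.
    by rewrite /= ltrD2l ltrN2.
  rewrite (_ : _ @^-1` _ = f @^-1` [set z | x < h z]).
    rewrite -[_ @^-1` _]setTI; apply: mf => //.
    exact: sub_sigma_algebra.
  by apply/seteqP; split => t /=; rewrite in_itv/= andbT.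
split; apply: openRe => x y.
  have -> : Re x - Re y = Re (x - y) by case: x; case: y.
  exact: ler_Re_cabs.
have -> : Im x - Im y = Im (x - y) by case: x; case: y.
rewrite -(@ler_pXn2r _ 2) ?nnegrE ?cabs_ge0//.
by rewrite cabs_sqr real_normK ?num_real// lerDr sqr_ge0.
Qed.

End measurable_approximation.

(** * Construction of the series *)

Section representation.
Variable R : realType.
Notation mu := (@torus_measure R).
Notation T := (torus R).
Notation e := (@torus_exp R).
Implicit Types (r f : T -> R[i]) (P Q H : {poly R[i]}).
Local Open Scope complex_scope.

(** * The correction F (1 - H(e^{int})) and its partial sums *)

Section modulated_kernel.
Variables (Q H : {poly R[i]}) (K n : nat).
Hypotheses (KQn : (K + size Q <= n)%N) (H0 : H`_0 = 1).
Let F t := Q.[e 1 t] / e 1 t ^+ K.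

(** The part of F (1 - H(e^{int})) coming from the coefficients 1 to J of H. As n >= K + size Q, the
    shifted copies of Q occupy disjoint ranges of positions. *)
Definition modulated_kernel J : {poly R[i]} :=
  \sum_(j < J) (- H`_j.+1) *: (Q * 'X^(j.+1 * n - K)).

Lemma modulated_kernelS J : modulated_kernel J.+1 =
  modulated_kernel J + (- H`_J.+1) *: (Q * 'X^(J.+1 * n - K)).
Proof. by rewrite /modulated_kernel big_ord_recr. Qed.

Lemma torus_exp_sub j t : e 1 t ^+ (j.+1 * n - K) = e n t ^+ j.+1 / e 1 t ^+ K.
Proof.
have Kn : (K <= j.+1 * n)%N.
  by apply: leq_trans (leq_addr (size Q) K) (leq_trans KQn _); rewrite leq_pmull.
rewrite expfB_cond; last by rewrite (negbTE (torus_exp_neq0 1 t)) add0n.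
by rewrite (torus_exp1X n) -exprM mulnC.
Qed.

Lemma modulated_kernelE J t : (modulated_kernel J).[e 1 t] =
  F t * (1 - (take_poly J.+1 H).[e n t]).
Proof.
rewrite /take_poly horner_poly big_ord_recl/= H0 expr0 mulr1 opprD addNKr.
rewrite /modulated_kernel horner_sum mulrN mulr_sumr -sumrN; apply: eq_bigr => j _.
rewrite hornerZ hornerM hornerXn torus_exp_sub /F /bump/= add1n; ring.
Qed.

Lemma size_modulated_kernel J : (size (modulated_kernel J) <= J.+1 * n - K)%N.
Proof.
elim: J => [|J IH]; first by rewrite /modulated_kernel big_ord0 size_poly0.
rewrite modulated_kernelS; apply: leq_trans (size_polyD _ _) _.
have mulE : (J.+2 * n = J.+1 * n + n)%N by rewrite mulSn addnC.
have nn : (n <= J.+1 * n)%N by rewrite leq_pmull.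
rewrite geq_max; apply/andP; split; first by apply: leq_trans IH _; rewrite leq_sub2r// mulE leq_addr.
apply: leq_trans (size_scale_leq _ _) _; have [->|Q0] := eqVneq Q 0.
  by rewrite mul0r size_poly0.
rewrite size_mulXn// mulE; move: (J.+1 * n)%N nn KQn => a; lia.
Qed.

(** A cut falls inside at most one copy of Q, and that copy carries a tiny coefficient of H. *)
Lemma take_modulated_kernel J M : exists j, exists s,
  take_poly M (modulated_kernel J) = modulated_kernel j +
    (- H`_j.+1) *: (take_poly s Q * 'X^(j.+1 * n - K)).
Proof.
elim: J => [|J [j [s IH]]].
  exists 0%N, 0%N; rewrite /modulated_kernel big_ord0 take_poly0r take_poly0l.
  by rewrite mul0r scaler0 addr0.
rewrite modulated_kernelS take_polyD take_polyZ take_polyMXn.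
have [MJ|MJ] := leqP M (J.+1 * n - K).
  exists j, s; rewrite IH (_ : (M - _)%N = 0%N) ?take_poly0l ?mul0r ?scaler0 ?addr0//.
  by apply/eqP; rewrite subn_eq0.
exists J, (M - (J.+1 * n - K))%N; rewrite take_poly_id//.
exact: leq_trans (size_modulated_kernel J) (ltnW MJ).
Qed.

Lemma coef_modulated_kernel J k : (k + K < n)%N -> (modulated_kernel J)`_k = 0.
Proof.
move=> kn; rewrite /modulated_kernel coef_sum big1// => j _.
rewrite coefZ coefMXn ifT ?mulr0//.
by rewrite ltn_subRL addnC (leq_trans kn)// leq_pmull.
Qed.

End modulated_kernel.

Lemma cabs_take_poly_le s Q t :
  cabs (take_poly s Q).[e 1 t] <= \sum_(i < size Q) cabs Q`_i.
Proof.
rewrite horner_coef; apply: le_trans (ler_cabs_sum _ _ _) _.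
have -> : \sum_(i < size (take_poly s Q)) cabs ((take_poly s Q)`_i * e 1 t ^+ i) =
    \sum_(i < size (take_poly s Q)) cabs (take_poly s Q)`_i.
  by apply: eq_bigr => i _; rewrite cabsM cabsX cabs_torus_exp expr1n mulr1.
have le_size : (size (take_poly s Q) <= size Q)%N.
  by apply/leq_sizeP => j Qj; rewrite coef_take_poly nth_default// if_same.
rewrite (big_ord_widen _ (fun i => cabs (take_poly s Q)`_i) le_size) big_mkcond.
apply: ler_sum => i _; rewrite coef_take_poly.
case: ifP => _; last exact: cabs_ge0.
by case: ifP => _; rewrite ?cabs0 ?cabs_ge0.
Qed.

Lemma approximation_step r (delta : R) N : cmeasurable r -> 0 < delta ->
  exists P, [/\ forall k, (k <= N)%N -> P`_k = 0,
    small delta [set t | cabs (r t) / 2 + delta < cabs (r t - P.[e 1 t])] &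
    forall M, small delta
      [set t | 6 * cabs (r t) + delta < cabs (take_poly M P).[e 1 t]]].
Proof.
(* With |r - F| <= d, the error is at most d + (|r| + d) / 2 and the partial sums at most 6 (|r| +
   d) + d; delta = 16 d leaves room for both. *)
move=> mr d0; pose d := delta / 16; have dd : 0 < d by rewrite divr_gt0.
have [F [K [Q FE]] rF] := tapprox_measurable mr dd.
pose C : R := \sum_(i < size Q) cabs Q`_i + 1.
have C0 : 0 < C by rewrite ltr_wpDl// sumr_ge0// => i _; exact: cabs_ge0.
have d'0 : 0 < Num.min d (d / C) by rewrite lt_min dd divr_gt0.
(* Large enough to separate the copies of Q and to leave all frequencies up to N empty. *)
pose n := (K + size Q + N).+1.
have [H [H0 Hc Hs Ht]] := kernel_exists d'0 (isT : (0 < n)%N).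
have d'1 : Num.min d (d / C) <= d by rewrite ge_min lexx.
have d'2 : Num.min d (d / C) <= d / C by rewrite ge_min lexx orbT.
have KQn : (K + size Q <= n)%N by rewrite /n -addnS leq_addr.
have Fr t : cabs (r t - F t) <= d -> cabs (F t) <= cabs (r t) + d.
  move=> h; rewrite -(subrK (r t) (F t)) addrC.
  by apply: le_trans (ler_cabsD _ _) _; rewrite lerD2l cabsB.
exists (modulated_kernel Q H K n (size H)); split.
- move=> k kN; apply: coef_modulated_kernel.
  by rewrite /n ltnS addnC -addnA leq_add2l (leq_trans kN)// leq_addl.
- apply: (small_sub _ _ (smallU rF Hs)); last by rewrite /d in d'1 *; lra.
  move=> t /= h; have [h1|h1] := ltP d (cabs (r t - F t)); first by left.
  right; rewrite ltNge; apply/negP => h2; move: h; rewrite ltNge => /negP; apply.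
  rewrite modulated_kernelE// -FE take_poly_id//.
  rewrite (_ : r t - _ = (r t - F t) + F t * H.[e n t]); last by ring.
  apply: le_trans (ler_cabsD _ _) _; rewrite cabsM.
  have : cabs (F t) * cabs H.[e n t] <= (cabs (r t) + d) * 2^-1.
    by apply: ler_pM; rewrite ?cabs_ge0//; exact: Fr.
  by rewrite /d in h1 *; lra.
move=> M; have [j [s ->]] := take_modulated_kernel H KQn (size H) M.
apply: (small_sub _ _ (smallU rF (Ht j.+1))); last by rewrite /d in d'1 *; lra.
move=> t /= h; have [h1|h1] := ltP d (cabs (r t - F t)); first by left.
right; rewrite ltNge; apply/negP => h2; move: h; rewrite ltNge => /negP; apply.
rewrite hornerD modulated_kernelE// -FE hornerZ hornerM hornerXn.
apply: le_trans (ler_cabsD _ _) _; rewrite !cabsM cabsN cabsX cabs_torus_exp expr1n mulr1.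
have h3 : cabs (F t) * cabs (1 - (take_poly j.+1 H).[e n t]) <= (cabs (r t) + d) * 6.
  apply: ler_pM; rewrite ?cabs_ge0//; first exact: Fr.
  by have := ler_cabsB 1 (take_poly j.+1 H).[e n t]; rewrite cabs1; lra.
have h4 : cabs H`_j.+1 * cabs (take_poly s Q).[e 1 t] <= d / C * C.
  apply: ler_pM; rewrite ?cabs_ge0//; first exact: le_trans (Hc _ _) d'2.
  by apply: le_trans (cabs_take_poly_le _ _ _) _; rewrite lerDl.
by rewrite divfK ?gt_eqF// in h4; rewrite /d in h3 h4 *; lra.
Qed.

Lemma half_pow_small (x : R) : 0 < x ->
  exists m, forall k, (m <= k)%N -> 2^-1 ^+ k <= x.
Proof.
move=> x0; exists (Num.bound x^-1) => k mk; rewrite exprVn -[leRHS]invrK.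
by rewrite lef_pV2 ?posrE ?invr_gt0 ?exprn_gt0//; exact/ltW/upper_nthrootP.
Qed.

(** * Iteration of the correction and convergence in measure *)

Section iteration.
Variables (f : T -> R[i]) (mf : cmeasurable f) (P S : nat -> {poly R[i]}).
Hypotheses (S0 : S 0%N = 0) (SS : forall j, S j.+1 = S j + P j).
Let r j t := f t - (S j).[e 1 t].
Hypothesis Pcoef : forall j k, (k <= size (S j) + j)%N -> (P j)`_k = 0.
Hypothesis Phalf : forall j, small (2^-1 ^+ j)
  [set t | cabs (r j t) / 2 + 2^-1 ^+ j < cabs (r j t - (P j).[e 1 t])].
Hypothesis Ppartial : forall j M, small (2^-1 ^+ j)
  [set t | 6 * cabs (r j t) + 2^-1 ^+ j < cabs (take_poly M (P j)).[e 1 t]].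

Let mr j : cmeasurable (r j).
Proof.
exact: (cmeasurableB mf (cmeasurable_horner (S j) (cmeasurable_torus_exp R 1))).
Qed.

(** Since [P j] starts above the degree of [S j], a cut falls inside one block only, and a cut at or
    beyond the size of [S j0] falls in a block of index at least j0. *)
Lemma partial_sum_block j0 J M : (j0 <= J)%N -> (size (S j0) <= M)%N ->
  exists2 j, (j0 <= j)%N & exists M', take_poly M (S J) = S j + take_poly M' (P j).
Proof.
move=> + SM; elim: J => [|J IH].
  rewrite leqn0 => /eqP j00; exists 0%N; rewrite ?j00//; exists 0%N.
  by rewrite take_poly0l addr0 take_poly_id// -j00.
rewrite leq_eqVlt ltnS => /orP[/eqP <-|jJ].
  by exists j0 => //; exists 0%N; rewrite take_poly0l addr0 take_poly_id.
rewrite SS take_polyD; have [MJ|MJ] := leqP M (size (S J)).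
  have [j j0j [M' IHj]] := IH jJ; exists j => //; exists M'; rewrite IHj.
  rewrite [X in _ + X](_ : _ = 0) ?addr0//; apply/polyP => k.
  rewrite coef_take_poly coef0; case: ifP => // kM; apply: Pcoef.
  exact: leq_trans (leq_trans (ltnW kM) MJ) (leq_addr _ _).
by exists J => //; exists M; rewrite (take_poly_id (ltnW MJ)).
Qed.

Lemma coef_stable J k : (k <= J)%N -> (S J)`_k = (S k)`_k.
Proof.
elim: J => [|J IH]; first by rewrite leqn0 => /eqP ->.
rewrite leq_eqVlt ltnS => /orP[/eqP -> //|kJ].
by rewrite SS coefD IH// Pcoef ?addr0// (leq_trans kJ)// leq_addl.
Qed.

(** The diagonal coefficients are the limiting ones by [coef_stable]; the constant term is that of
    [S 0], namely 0, so the sum may start at 1. *)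
Lemma partial_sumE M t : \sum_(1 <= k < M.+1) (S k)`_k * e k t =
  (take_poly M.+1 (S M)).[e 1 t].
Proof.
rewrite /take_poly horner_poly -(big_mkord xpredT (fun i => (S M)`_i * e 1 t ^+ i)).
rewrite big_ltn// coef_stable// S0 coef0 mul0r add0r.
rewrite !big_nat; apply: eq_bigr => k /andP[_ kM].
by rewrite coef_stable// -torus_exp1X.
Qed.

(** Iterating |r_{j+1}| <= |r_j| / 2 + 2^{-j} from m on keeps the accumulated error below 2 2^{-m};
    the exceptional sets add up geometrically. *)
Lemma residual_step m i :
  small (2 * 2^-1 ^+ m * (1 - 2^-1 ^+ i)) [set t |
    2^-1 ^+ i * cabs (r m t) + 2 * 2^-1 ^+ m < cabs (r (m + i) t)].
Proof.
have h0 k : 0 < (2^-1 : R) ^+ k by rewrite exprn_gt0 ?invr_gt0.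
elim: i => [|i IH].
  rewrite expr0 subrr mulr0; apply: (small_sub _ _ (small_set0 (lexx 0))) => // t /=.
  by rewrite addn0 mul1r ltNge => /negP; apply; rewrite lerDl mulr_ge0 ?ltW.
apply: (small_sub _ _ (smallU IH (Phalf (m + i)))); last first.
  by rewrite exprD exprS le_eqVlt; apply/orP; left; apply/eqP; field.
move=> t /= h; have [h1|h1] := ltP (2^-1 ^+ i * cabs (r m t) + 2 * 2^-1 ^+ m)
  (cabs (r (m + i) t)); first by left.
right => /=; rewrite (_ : _ - _ = r (m + i.+1) t); last first.
  by rewrite /r addnS SS hornerD opprD addrA.
apply: le_lt_trans _ h; rewrite exprD exprS.
have i1 : (2^-1 : R) ^+ i <= 1 by apply: exprn_ile1; lra.
have : (2^-1 : R) ^+ m * 2^-1 ^+ i <= 2^-1 ^+ m by rewrite ler_piMr// ltW.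
lra.
Qed.

(** First m makes the accumulated errors small, then k bounds the fixed function r_m off a small
    set, and finally i makes 2^{-i} k small. *)
Lemma residual_small (eta : R) : 0 < eta ->
  exists j0, forall j, (j0 <= j)%N -> small eta [set t | eta < cabs (r j t)].
Proof.
move=> e0.
have [m mP] : exists m, forall k, (m <= k)%N -> 2^-1 ^+ k <= eta / 8.
  by apply: half_pow_small; rewrite divr_gt0.
have m8 := mP m (leqnn m).
pose D k := [set t | k%:R <= cabs (r m t)].
have [k Dk] : exists k, small (eta / 2) (D k).
  apply: small_cvg; first by rewrite divr_gt0.
  - move=> k; apply: measurable_ger; first exact: measurable_cst.
    exact: measurable_cabs.
  - by move=> n l nl t /=; apply: le_trans; rewrite ler_nat.
  - apply/seteqP; split => // t h; have := h (Num.bound (cabs (r m t))) I.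
    by rewrite /D/= leNgt archi_boundP ?cabs_ge0.
have [i0 i0P] : exists i0, forall i, (i0 <= i)%N -> 2^-1 ^+ i <= eta / 2 / k.+1%:R.
  by apply: half_pow_small; rewrite !divr_gt0.
exists (m + i0)%N => j mj; have [i ij jE] : exists2 i, (i0 <= i)%N & j = (m + i)%N.
  exists (j - m)%N; first by rewrite leq_subRL// (leq_trans (leq_addr i0 m)).
  by rewrite subnKC// (leq_trans (leq_addr i0 m)).
have hi0 : 0 < (2^-1 : R) ^+ i by rewrite exprn_gt0 ?invr_gt0.
have hm0 : 0 < (2^-1 : R) ^+ m by rewrite exprn_gt0 ?invr_gt0.
apply: (small_sub _ _ (smallU Dk (residual_step m i))); last first.
  have : 0 <= 2 * 2^-1 ^+ m * 2^-1 ^+ i :> R by rewrite !mulr_ge0 ?ltW.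
  by rewrite mulrBr mulr1; lra.
move=> t; rewrite /D/= jE => h.
have [h1|h1] := leP k%:R (cabs (r m t)); first by left.
right => /=; apply: le_lt_trans _ h.
have : 2^-1 ^+ i * cabs (r m t) <= eta / 2 / k.+1%:R * k.+1%:R.
  apply: ler_pM; rewrite ?cabs_ge0 ?(ltW hi0) ?i0P//.
  by rewrite (le_trans (ltW h1))// ler_nat.
rewrite divfK ?pnatr_eq0//; lra.
Qed.

Lemma partial_sums_cvg :
  cvg_in_measure mu (fun N t => \sum_(1 <= k < N.+1) (S k)`_k * e k t) f.
Proof.
move=> eps eps0.
pose A N := [set t | eps <= cabs ((take_poly N.+1 (S N)).[e 1 t] - f t)].
have AE N : [set t | eps%:C <= `|\sum_(1 <= k < N.+1) (S k)`_k * e k t - f t|] = A N.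
  by apply/seteqP; split => t /=; rewrite partial_sumE norm_cabs lecR.
under eq_fun do rewrite AE.
have mA N : measurable (A N).
  apply: measurable_ger; first exact: measurable_cst.
  apply: measurable_cabs; apply: cmeasurableB mf.
  exact: (cmeasurable_horner _ (cmeasurable_torus_exp R 1)).
have small_A (d : R) : 0 < d -> exists N0, forall N, (N0 <= N)%N -> small d (A N).
  move=> d0; pose eta := Num.min eps d / 16.
  have m0 : 0 < Num.min eps d by rewrite lt_min eps0.
  have eta0 : 0 < eta by rewrite divr_gt0.
  have etae : 16 * eta <= eps by rewrite mulrC divfK// ge_min lexx.
  have etad : 16 * eta <= d by rewrite mulrC divfK// ge_min lexx orbT.
  have [j1 j1P] := residual_small eta0.
  have [j2 j2P] := half_pow_small eta0.
  pose j0 := maxn j1 j2; exists (maxn j0 (size (S j0))) => N.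
  rewrite geq_max => /andP[jN sN].
  have [j j0j [M SE]] := partial_sum_block jN (leq_trans sN (leqnSn N)).
  have j1j : (j1 <= j)%N by rewrite (leq_trans _ j0j)// leq_maxl.
  have j2j : (j2 <= j)%N by rewrite (leq_trans _ j0j)// leq_maxr.
  have h2 := j2P j j2j.
  apply: (small_sub _ _ (smallU (j1P j j1j) (Ppartial j M))); last by lra.
  move=> t; rewrite /A/= SE hornerD => h.
  have [h3|h3] := ltP eta (cabs (r j t)); first by left.
  right; rewrite ltNge; apply/negP => h4; move: h; rewrite leNgt => /negP; apply.
  (* The error is at most 7 |r_j| + 2^{-j} <= 8 eta, below 16 eta <= eps. *)
  rewrite (_ : _ - _ = (take_poly M (P j)).[e 1 t] - r j t); last by rewrite /r; ring.
  apply: le_lt_trans (ler_cabsB _ _) _; lra.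
apply/fine_cvgP; split.
  have [N1 N1P] := small_A 1 ltr01; exists N1 => // N /N1P /(small_mu (mA N)) h.
  by rewrite ge0_fin_numE ?torus_measure_ge0// (le_lt_trans h)// ltry.
apply/cvgrPdist_lt => d d0; have d2 : 0 < d / 2 by rewrite divr_gt0.
have [N1 N1P] := small_A _ d2; exists N1 => // N /N1P /(small_mu (mA N)) h.
have m0 := torus_measure_ge0 (A N).
have mfin : torus_measure (A N) \is a fin_num.
  by rewrite ge0_fin_numE// (le_lt_trans h)// ltry.
rewrite /= sub0r normrN ger0_norm ?fine_ge0//.
rewrite -lte_fin fineK//; apply: le_lt_trans h _.
by rewrite lte_fin ltr_pdivrMr// mulr_natr mulr2n ltrDl.
Qed.

End iteration.

End representation.

Theorem theorem3 (R : realType) (f : torus R -> R[i]) (hf : L0 f) :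
  exists c : nat -> R[i],
    cvg_in_measure (torus_measure (R := R))
      (fun N t => \sum_(1 <= k < N.+1) c k * torus_exp k t) f.
Proof.
have mf := L0_cmeasurable hf.
pose r (Q : {poly R[i]}) t := f t - Q.[torus_exp 1 t].
have mr Q : cmeasurable (r Q).
  exact: (cmeasurableB mf (cmeasurable_horner Q (cmeasurable_torus_exp R 1))).
have half0 j : 0 < (2^-1 : R) ^+ j by rewrite exprn_gt0 ?invr_gt0.
(* A correction is chosen for every stage j and every polynomial Q built so far, which makes the
   recursion a plain fixpoint. It avoids frequencies up to size Q + j: the first term separates the
   blocks, the second freezes coefficient k from stage k on. *)
have /choice[P PP] (jQ : nat * {poly R[i]}) :=
  approximation_step (size jQ.2 + jQ.1) (mr jQ.2) (half0 jQ.1).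
pose S := fix S j := if j is j'.+1 then S j' + P (j', S j') else 0.
exists (fun k => (S k)`_k).
apply: (@partial_sums_cvg R f mf (fun j => P (j, S j)) S) => // j.
- by move=> k; have [h _ _] := PP (j, S j); exact: h.
- by have [_ h _] := PP (j, S j).
- by move=> M; have [_ _ h] := PP (j, S j); exact: h.
Qed.
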